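(* Let $q=p^n$ with $p$ an odd prime and $n\ge 1$. Consider all the quasi-Hermitian varieties $\mathcal M_{\alpha,\beta}$ of $\mathrm{PG}(3,q^2)$, where $(\alpha,\beta)$ ranges over the pairs with $\alpha\in\mathrm{GF}(q^2)\setminus\{0\}$, $\beta\in\mathrm{GF}(q^2)\setminus\mathrm{GF}(q)$ and $4\alpha^{q+1}+(\beta^q-\beta)^2\neq 0$. Then the number $N$ of equivalence classes of these varieties (two of them being equivalent when some semilinear collineation in $\mathrm{P\Gamma L}(4,q^2)$ maps one onto the other) is \[N=\frac{1}{n}\left(\sum_{k\mid n}\Phi\left(\frac{n}{k}\right)p^k\right)-2,\] where $\Phi$ is the Euler totient function.
   Context: Let $q$ be an odd prime power and let $(J,X,Y,Z)$ be homogeneous coordinates of $\mathrm{PG}(3,q^2)$. Let $\Sigma_\infty$ be the plane $J=0$ (the plane at infinity). Points not on $\Sigma_\infty$ are called affine. For $\alpha\in\mathrm{GF}(q^2)\setminus\{0\}$ and $\beta\in\mathrm{GF}(q^2)\setminus\mathrm{GF}(q)$ with $4\alpha^{q+1}+(\beta^q-\beta)^2\neq 0$, let $\mathcal B_{\alpha,\beta}$ be the set of points of $\mathrm{PG}(3,q^2)$ satisfying \[Z^qJ^q-ZJ^{2q-1}+\alpha^q(X^{2q}+Y^{2q})-\alpha(X^2+Y^2)J^{2q-2}=(\beta^q-\beta)(X^{q+1}+Y^{q+1})J^{q-1},\] let $\mathcal F=\{(0,X,Y,Z): X^{q+1}+Y^{q+1}=0\}\subset\Sigma_\infty$, and define \[\mathcal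 M_{\alpha,\beta}:=(\mathcal B_{\alpha,\beta}\setminus\Sigma_\infty)\cup\mathcal F .\] The set $\mathcal M_{\alpha,\beta}$ is called the BM quasi-Hermitian variety of parameters $\alpha,\beta$. (A quasi-Hermitian variety is a point set with the same size and the same intersection numbers with hyperplanes as a non-singular Hermitian variety; it is known that $\mathcal M_{\alpha,\beta}$ is one under the stated condition on $\alpha,\beta$.) Two such varieties $\mathcal M_{\alpha,\beta}$ and $\mathcal M_{\alpha',\beta'}$ are equivalent if there is a semilinear collineation $\psi\in\mathrm{P\Gamma L}(4,q^2)$ with $\psi(\mathcal M_{\alpha,\beta})=\mathcal M_{\alpha',\beta'}$. *)

(* Defs.v *)
From HB Require Import structures.
From mathcomp Require Import all_boot all_order all_fingroup all_algebra.

Set Implicit Arguments.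
Unset Strict Implicit.
Unset Printing Implicit Defensive.

Import GRing.Theory.
Local Open Scope ring_scope.

Section ProjectiveSpace.
Variable F : finFieldType.
Implicit Types (v : 'rV[F]_4) (P : {set 'rV[F]_4}) (S : {set {set 'rV[F]_4}}).

Definition point_of v : {set 'rV[F]_4} := [set a *: v | a : F].

(* Points of PG(3, F) are the 1-dimensional subspaces of F^4, each one being
   the set of its vectors; a set of points is thus a set of sets of vectors. *)
Definition PG3 : {set {set 'rV[F]_4}} :=
  [set point_of v | v : 'rV[F]_4 & v != 0].

Definition cJ v : F := v 0 (inord 0).
Definition cX v : F := v 0 (inord 1).
Definition cY v : F := v 0 (inord 2).
Definition cZ v : F := v 0 (inord 3).

Definition is_field_aut (s : {perm F}) : bool :=
  [&& s 1 == 1,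
      [forall x, forall y, s (x + y) == s x + s y]
    & [forall x, forall y, s (x * y) == s x * s y]].

Definition semilinear (A : 'M[F]_4) (s : {perm F}) v : 'rV[F]_4 :=
  map_mx s v *m A.

Definition collineation (A : 'M[F]_4) (s : {perm F}) P : {set 'rV[F]_4} :=
  semilinear A s @: P.

Definition PGammaL_equiv : rel {set {set 'rV[F]_4}} := fun S S' =>
  [exists A in unitmx, exists s : {perm F},
     is_field_aut s && (collineation A s @: S == S')].

Lemma is_field_autM s t :
  is_field_aut s -> is_field_aut t -> is_field_aut (s * t)%g.
Proof.
case/and3P=> /eqP s1 /forallP sD /forallP sM.
case/and3P=> /eqP t1 /forallP tD /forallP tM.
apply/and3P; split; first by rewrite permM s1 t1.
- apply/forallP=> x; apply/forallP=> y; rewrite !permM.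
  by rewrite (eqP (forallP (sD x) y)) (eqP (forallP (tD _) _)).
- apply/forallP=> x; apply/forallP=> y; rewrite !permM.
  by rewrite (eqP (forallP (sM x) y)) (eqP (forallP (tM _) _)).
Qed.

Lemma is_field_autV s : is_field_aut s -> is_field_aut s^-1%g.
Proof.
case/and3P=> /eqP s1 /forallP sD /forallP sM.
apply/and3P; split.
- by rewrite -(inj_eq (@perm_inj _ s)) permKV s1.
- apply/forallP=> x; apply/forallP=> y.
  by rewrite -(inj_eq (@perm_inj _ s)) (eqP (forallP (sD _) _)) !permKV.
- apply/forallP=> x; apply/forallP=> y.
  by rewrite -(inj_eq (@perm_inj _ s)) (eqP (forallP (sM _) _)) !permKV.
Qed.

Lemma is_field_aut_mulmx s m k l (A : 'M[F]_(m, k)) (B : 'M[F]_(k, l)) :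
  is_field_aut s -> map_mx s (A *m B) = map_mx s A *m map_mx s B.
Proof.
case/and3P=> _ /forallP sD /forallP sM.
have s0 : s 0 = 0.
  by apply: (addrI (s 0)); rewrite -(eqP (forallP (sD _) _)) !addr0.
have sD' : {morph s : x y / x + y} by move=> x y; apply/eqP; exact: (forallP (sD x) y).
apply/matrixP=> i j; rewrite !mxE (big_morph s sD' s0).
by apply: eq_bigr => h _; rewrite !mxE; apply/eqP; exact: (forallP (sM _) _).
Qed.

Lemma is_field_aut_unitmx s (A : 'M[F]_4) :
  is_field_aut s -> A \in unitmx -> map_mx s A \in unitmx.
Proof.
move=> hs uA; have := is_field_aut_mulmx A (invmx A) hs; rewrite mulmxV //.
suff -> : map_mx s 1%:M = 1%:M :> 'M[F]_4.
  by move=> e; have [] := mulmx1_unit (esym e).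
case/and3P: hs => /eqP s1 /forallP sD _; apply/matrixP=> i j; rewrite !mxE.
case: (i == j) => //=; rewrite ?mulr1n ?mulr0n //.
by apply: (addrI (s 0)); rewrite -(eqP (forallP (sD _) _)) !addr0.
Qed.

Lemma PGammaL_equiv_equivalence : equivalence_rel PGammaL_equiv.
Proof.
have coll2 A s B t S : is_field_aut t ->
    collineation B t @: (collineation A s @: S)
      = collineation (map_mx t A *m B) (s * t)%g @: S.
  move=> ht; rewrite -imset_comp; apply: eq_imset => P /=.
  rewrite /collineation -imset_comp; apply: eq_imset => v /=.
  rewrite /semilinear (is_field_aut_mulmx _ _ ht) mulmxA; congr (_ *m _ *m _).
  by apply/matrixP=> i j; rewrite !mxE permM.
have coll1 S : collineation 1%:M 1%g @: S = S.
  rewrite -[RHS]imset_id; apply: eq_imset => P /=.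
  rewrite /collineation -[RHS]imset_id; apply: eq_imset => v /=.
  rewrite /semilinear mulmx1; apply/matrixP=> i j.
  by rewrite !mxE perm1.
have aut1 : is_field_aut 1%g.
  by apply/and3P; split; rewrite ?perm1 //;
     apply/forallP=> x; apply/forallP=> y; rewrite !perm1.
have refl S : PGammaL_equiv S S.
  apply/exists_inP; exists 1%:M; first exact: unitmx1.
  by apply/existsP; exists 1%g; rewrite aut1 coll1 eqxx.
have trans S1 S2 S3 :
    PGammaL_equiv S1 S2 -> PGammaL_equiv S2 S3 -> PGammaL_equiv S1 S3.
  case/exists_inP=> A uA /existsP[s /andP[hs /eqP <-]].
  case/exists_inP=> B uB /existsP[t /andP[ht /eqP <-]].
  apply/exists_inP; exists (map_mx t A *m B).
    by rewrite unitmx_mul uB is_field_aut_unitmx.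
  by apply/existsP; exists (s * t)%g; rewrite is_field_autM // coll2 ?eqxx.
have sym S1 S2 : PGammaL_equiv S1 S2 -> PGammaL_equiv S2 S1.
  case/exists_inP=> A uA /existsP[s /andP[hs /eqP <-]].
  have hsV := is_field_autV hs.
  have uA' := is_field_aut_unitmx hsV uA.
  apply/exists_inP; exists (invmx (map_mx s^-1%g A)).
    by rewrite unitmx_inv.
  apply/existsP; exists s^-1%g.
  by rewrite hsV coll2 // mulmxV // mulgV coll1 eqxx.
move=> S1 S2 S3; split=> // h12.
by apply/idP/idP=> h; [apply: trans h; apply: sym | apply: trans h].
Qed.

End ProjectiveSpace.

Section BMVarieties.
Variables (F : finFieldType) (q : nat).
Implicit Types (a b : F) (v : 'rV[F]_4).

(* The subfield of order q of a field of order q^2. *)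
Definition GFq : {set F} := [set x : F | x ^+ q == x].

Definition plane_at_infinity : {set {set 'rV[F]_4}} :=
  [set P in PG3 F | [forall v in P, cJ v == 0]].

Definition B_equation a b v : bool :=
  cZ v ^+ q * cJ v ^+ q - cZ v * cJ v ^+ (2 * q - 1)
    + a ^+ q * (cX v ^+ (2 * q) + cY v ^+ (2 * q))
    - a * (cX v ^+ 2 + cY v ^+ 2) * cJ v ^+ (2 * q - 2)
  == (b ^+ q - b) * (cX v ^+ (q + 1) + cY v ^+ (q + 1)) * cJ v ^+ (q - 1).

Definition B_set a b : {set {set 'rV[F]_4}} :=
  [set P in PG3 F | [forall v in P, B_equation a b v]].

Definition F_set : {set {set 'rV[F]_4}} :=
  [set P in plane_at_infinity |
    [forall v in P, cX v ^+ (q + 1) + cY v ^+ (q + 1) == 0]].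

Definition BM_variety a b : {set {set 'rV[F]_4}} :=
  (B_set a b :\: plane_at_infinity) :|: F_set.

Definition BM_params : {set F * F} :=
  [set ab : F * F | [&& ab.1 != 0, ab.2 \notin GFq
    & 4%:R * ab.1 ^+ (q + 1) + (ab.2 ^+ q - ab.2) ^+ 2 != 0]].

Definition BM_varieties : {set {set {set 'rV[F]_4}}} :=
  [set BM_variety ab.1 ab.2 | ab in BM_params].

Definition BM_classes : {set {set {set {set 'rV[F]_4}}}} :=
  equivalence_partition (@PGammaL_equiv F) BM_varieties.

End BMVarieties.

(* Main.v *)
(* Put T(w) = w^q - w and d = beta^q - beta. In affine coordinates the variety is
   T(z + alpha (x^2 + y^2)) = d (x^(q+1) + y^(q+1)). The point (0, 0, 0, 1) is the
   only one that lies on a line of the variety whose other points lie on no second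
   line of the variety, so an equivalence fixes it, and also fixes the plane at
   infinity, spanned by the lines of the variety through that point. Restricting
   the affine equation to lines and comparing coefficients, which is legitimate
   since all degrees are at most 2q < q^2, shows that the equivalence is a
   similitude both of x^2 + y^2 and of x^(q+1) + y^(q+1). Therefore
   4 alpha^(q+1) / d^2, which lies in GF(q) minus {0, -1}, is preserved up to a
   field automorphism; by Hilbert 90 it is a complete invariant and takes every
   such value. The classes are thus the Frobenius orbits on GF(q) minus {0, -1},
   counted by Burnside's lemma: x^(p^i) = x has p^gcd(i, n) solutions in GF(q). *)
Require Import Defs.
From HB Require Import structures.
From mathcomp Require Import all_boot all_order all_fingroup all_algebra.
From mathcomp Require Import all_solvable all_field ring zify.

Set Implicit Arguments.
Unset Strict Implicit.
Unset Printing Implicit Defensive.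

Import GRing.Theory.
Local Open Scope ring_scope.

(** * Finite fields: roots of unity, Frobenius fixed points, automorphisms *)

Section FiniteFields.
Variable F : finFieldType.

Lemma finField_card_pred_gt0 : (0 < #|F|.-1)%N.
Proof. by have := finNzRing_gt1 F; case: #|F| => [|[|]]. Qed.

Lemma expf_card_pred (x : F) : x != 0 -> x ^+ #|F|.-1 = 1.
Proof.
move=> x0; apply: (mulfI x0); rewrite -exprS mulr1 prednK ?expf_card //.
exact: ltnW (finNzRing_gt1 F).
Qed.

Lemma finField_prim_root : exists z : F, (#|F|.-1).-primitive_root z.
Proof.
have n_gt0 := finField_card_pred_gt0.
have /hasP[z _ zP] : has (#|F|.-1).-primitive_root (enum (predC1 (0 : F))).
  apply: has_prim_root => //; rewrite ?enum_uniq //.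
    apply/allP=> x; rewrite mem_enum inE => x0.
    by rewrite unity_rootE expf_card_pred.
  by rewrite -cardE cardC1.
by exists z.
Qed.

(** Cyclicity of the multiplicative group. When [#|F| = q ^ 2], the case [m = q + 1] is Hilbert 90
    over GF(q), and [m = q - 1] is surjectivity of the norm. *)
Lemma finField_root_of_unity m (x : F) : (m %| #|F|.-1)%N -> x ^+ m = 1 ->
  exists2 y : F, y != 0 & x = y ^+ (#|F|.-1 %/ m).
Proof.
move=> m_dv xm1; have [z zP] := finField_prim_root.
have [i ->] := prim_rootP (dvdn_prim_root zP m_dv) xm1.
exists (z ^+ i); last by rewrite exprAC.
by rewrite expf_neq0 // (prim_root_eq0 zP) -lt0n finField_card_pred_gt0.
Qed.

Lemma card_unity_roots m : (m %| #|F|.-1)%N -> #|[set x : F | x ^+ m == 1]| = m.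
Proof.
move=> m_dv; have [z zP] := finField_prim_root.
have uP := dvdn_prim_root zP m_dv; set u := z ^+ _ in uP.
have -> : [set x : F | x ^+ m == 1] = [set u ^+ i | i : 'I_m].
  apply/setP=> x; rewrite inE; apply/eqP/imsetP => [/(prim_rootP uP)[i ->]|].
    by exists i.
  by case=> i _ ->; rewrite exprAC (prim_expr_order uP) expr1n.
rewrite card_imset ?card_ord // => i j /eqP.
by rewrite (eq_prim_root_expr uP) !modn_small // => /eqP/val_inj.
Qed.

(** Bezout in the subtraction-free form [ki * i = kj * j + gcdn i j], which avoids inverting
    Frobenius. *)
Lemma expf_frobenius_fixed_gcd p i j (x : F) : (0 < i)%N ->
  x ^+ (p ^ i) = x -> x ^+ (p ^ j) = x -> x ^+ (p ^ gcdn i j) = x.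
Proof.
move=> i_gt0 xi xj.
have fixM a k : x ^+ (p ^ a) = x -> x ^+ (p ^ (k * a)) = x.
  by move=> xa; elim: k => [|k IH]; rewrite ?expr1 // mulSn expnD exprM xa.
case: (egcdnP j i_gt0) => ki kj e _.
by have := fixM _ ki xi; rewrite e expnD exprM fixM.
Qed.

Lemma expf_frobenius_fixed_dvd p i j (x : F) : (i %| j)%N ->
  x ^+ (p ^ i) = x -> x ^+ (p ^ j) = x.
Proof.
move=> /dvdnP[k ->] xi; elim: k => [|k IH]; rewrite ?expr1 //.
by rewrite mulSn expnD exprM xi.
Qed.

Variables (p e : nat).
Hypotheses (p_prime : prime p) (cardF : #|F| = (p ^ e)%N).

Lemma finField_exp_gt0 : (0 < e)%N.
Proof. by have := finNzRing_gt1 F; rewrite cardF; case: e. Qed.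

(** The nonzero solutions are the roots of unity of order dividing [p ^ d - 1], a divisor of
    [p ^ e - 1] because [d] divides [e]. *)
Lemma card_frobenius_fixed d : (d %| e)%N ->
  #|[set x : F | x ^+ (p ^ d) == x]| = (p ^ d)%N.
Proof.
move=> d_dv; have d_gt0 := dvdn_gt0 finField_exp_gt0 d_dv.
have pd_gt0 : (0 < p ^ d)%N by rewrite expn_gt0 prime_gt0.
have -> : [set x : F | x ^+ (p ^ d) == x]
    = 0 |: [set x : F | x ^+ (p ^ d).-1 == 1].
  apply/setP=> x; rewrite !inE; have [->|x0] := eqVneq x 0.
    by rewrite expr0n -(prednK pd_gt0) /= eqxx.
  by rewrite -{1}(prednK pd_gt0) exprS -[X in _ == X](mulr1 x) (inj_eq (mulfI x0)).
have pd1 : (1 < p ^ d)%N by rewrite -(expn0 p) ltn_exp2l ?prime_gt1.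
rewrite cardsU1 card_unity_roots; last first.
  by rewrite cardF -(divnK d_dv) mulnC expnM dvdn_pred_predX.
rewrite inE expr0n; have -> : ((p ^ d).-1 == 0)%N = false by lia.
by rewrite eq_sym oner_eq0 add1n prednK.
Qed.

(** The elements [k%:R] with [k < p] are distinct and fixed by Frobenius, which has only [p] fixed
    points. *)
Lemma finField_prime_subfield (x : F) : x ^+ p = x -> exists k, x = k%:R.
Proof.
move=> xp; have pF := card_finPcharP cardF p_prime.
pose S : {set F} := [set i%:R | i : 'I_p].
suff /setP/(_ x) : S = [set y : F | y ^+ (p ^ 1) == y].
  by rewrite inE expn1 xp eqxx => /imsetP[i _ ->]; exists i.
apply/eqP; rewrite eqEcard card_frobenius_fixed ?dvd1n //.
rewrite card_imset ?card_ord ?leqnn ?andbT; last first.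
  move=> i j; wlog le_ij : i j / (i <= j)%N => [hw eij|].
    by case: (leqP i j) => [/hw|/ltnW/hw]; [apply|move=> ->].
  move/esym/eqP; rewrite -subr_eq0 -natrB // -(dvdn_pcharf pF) => dv.
  by apply: val_inj => /=; have := ltn_ord j; have := ltn_ord i; move: dv;
    case: (posnP (j - i)) => [|/dvdn_leq h /h]; lia.
apply/subsetP=> _ /imsetP[i _ ->]; rewrite inE expn1.
by rewrite -(pFrobenius_autE pF) pFrobenius_aut_nat.
Qed.

(* The orbit polynomial of a primitive element z under Frobenius has its
   coefficients in the prime field, hence s z is a conjugate of z. *)
Lemma finField_rmorph_frobenius (s : {rmorphism F -> F}) :
  exists2 j, (j < e)%N & forall x, s x = x ^+ (p ^ j).
Proof.
have pF := card_finPcharP cardF p_prime; have e_gt0 := finField_exp_gt0.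
have [z zP] := finField_prim_root.
pose f := \prod_(j < e) ('X - (z ^+ (p ^ j))%:P).
(* Frobenius shifts the factors of [f] cyclically; [z ^+ #|F| = z] closes the cycle. *)
have fphi : map_poly (pFrobenius_aut pF) f = f.
  rewrite /f rmorph_prod /=.
  under eq_bigr => j _ do
    rewrite rmorphB /= map_polyX map_polyC /= pFrobenius_autE -exprM -expnSr.
  have ee := prednK e_gt0; rewrite -ee.
  rewrite big_ord_recr [in RHS]big_ord_recl mulrC /=; congr (_ * _).
  by rewrite ee -cardF expf_card expn0 expr1.
have fs : map_poly s f = f.
  apply/polyP=> i; rewrite coef_map.
  have /finField_prime_subfield[k ->] : f`_i ^+ p = f`_i.
    by rewrite -{2}fphi coef_map.
  exact: (rmorph_nat s).
have : root f z.
  rewrite /f -(prednK e_gt0) big_ord_recl expn0 expr1 rootM root_XsubC.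
  by rewrite eqxx.
rewrite -(fmorph_root s) fs /f => /rootP.
rewrite horner_prod => /eqP/prodf_eq0[j _].
rewrite hornerXsubC subr_eq0 => /eqP sz.
exists j => // x; have [->|x0] := eqVneq x 0.
  by rewrite rmorph0 expr0n expn_eq0 -leqn0 leqNgt prime_gt0.
have [i ->] := prim_rootP zP (expf_card_pred x0).
by rewrite rmorphXn /= sz exprAC.
Qed.

End FiniteFields.

(** * Homogeneous coordinates and lines contained in a point set *)

Section Coordinates.
Variable F : finFieldType.
Implicit Types v w : 'rV[F]_4.

Definition vec4 (j x y z : F) : 'rV[F]_4 := \row_i nth 0 [:: j; x; y; z] i.

Lemma vec4E j x y z : (cJ (vec4 j x y z) = j) * (cX (vec4 j x y z) = x)
  * (cY (vec4 j x y z) = y) * (cZ (vec4 j x y z) = z).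
Proof. by rewrite /cJ /cX /cY /cZ !mxE !inordK. Qed.

Lemma hcoordD v w : (cJ (v + w) = cJ v + cJ w) * (cX (v + w) = cX v + cX w)
  * (cY (v + w) = cY v + cY w) * (cZ (v + w) = cZ v + cZ w).
Proof. by rewrite /cJ /cX /cY /cZ !mxE. Qed.

Lemma hcoordZ (a : F) v : (cJ (a *: v) = a * cJ v) * (cX (a *: v) = a * cX v)
  * (cY (a *: v) = a * cY v) * (cZ (a *: v) = a * cZ v).
Proof. by rewrite /cJ /cX /cY /cZ !mxE. Qed.

Lemma hcoordN v : (cJ (- v) = - cJ v) * (cX (- v) = - cX v)
   * (cY (- v) = - cY v) * (cZ (- v) = - cZ v).
Proof. by rewrite /cJ /cX /cY /cZ !mxE. Qed.

Definition hcoordE := (hcoordD, hcoordZ, hcoordN).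

Lemma hcoord0 : (cJ 0 = 0 :> F) * (cX 0 = 0 :> F) * (cY 0 = 0 :> F) * (cZ 0 = 0 :> F).
Proof. by rewrite /cJ /cX /cY /cZ !mxE. Qed.

Lemma eq_coord v w :
  cJ v = cJ w -> cX v = cX w -> cY v = cY w -> cZ v = cZ w -> v = w.
Proof.
move=> eJ eX eY eZ; apply/matrixP=> i j; rewrite !ord1.
by case: j => -[|[|[|[|//]]]] lt_j; [move: eJ | move: eX | move: eY | move: eZ];
  rewrite /cJ /cX /cY /cZ;
  [have -> : inord 0 = Ordinal lt_j | have -> : inord 1 = Ordinal lt_j
  |have -> : inord 2 = Ordinal lt_j | have -> : inord 3 = Ordinal lt_j];
  do ?[by []|apply: val_inj; rewrite /= inordK].
Qed.

Definition line_in (M : pred 'rV[F]_4) v w := forall a b, M (a *: v + b *: w).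

(* On a BM variety this holds at the point (0, 0, 0, 1) only: some line of [M]
   through [v] meets no other line of [M] outside [v]. *)
Definition isolated_line_point (M : pred 'rV[F]_4) v :=
  exists w, [/\ forall a, w != a *: v, line_in M v w
    & forall s u, line_in M (w + s *: v) u -> exists a b, u = a *: v + b *: w].

End Coordinates.

(** * The variety as a predicate on vectors, and identities in [s] and [conj s] *)

Section Cone.
Variables (F : finFieldType) (q : nat) (conj : {rmorphism F -> F}).
Hypotheses (conjE : forall x, conj x = x ^+ q) (q_odd : odd q) (q_gt2 : (2 < q)%N).
Hypotheses (cardF : #|F| = (q ^ 2)%N) (two_neq0 : 2%:R != 0 :> F).
Implicit Types (al de : F) (v w r : 'rV[F]_4).

Lemma conjK x : conj (conj x) = x.
Proof. by rewrite !conjE -exprM mulnn -cardF expf_card. Qed.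

(** The left side is a polynomial in [s] with exponents 2q, q+1, q, 2, 1, 0. These are distinct
    since q > 2, and 2q < q^2, so a nonzero polynomial could not vanish on all of [F]. *)
Lemma conj_poly_eq0 (p5 p4 p3 p2 p1 p0 : F) :
  (forall s, p5 * conj s ^+ 2 + p4 * (s * conj s) + p3 * conj s
     + p2 * s ^+ 2 + p1 * s + p0 = 0) ->
  [/\ p5 = 0, p4 = 0, p3 = 0 & [/\ p2 = 0, p1 = 0 & p0 = 0]].
Proof.
move=> H.
pose P := p5 *: 'X^(2 * q) + p4 *: 'X^(q.+1) + p3 *: 'X^q
  + p2 *: 'X^2 + p1 *: 'X^1 + p0 *: 'X^0.
have P0 : P = 0.
  apply/eqP/negPn/negP=> P_neq0.
  have /(max_poly_roots P_neq0) : all (root P) (enum F).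
    apply/allP=> s _; apply/rootP; rewrite -[RHS](H s) /P !conjE.
    by rewrite !(hornerD, hornerZ, hornerXn) -exprM mulnC expr1 expr0 mulr1 exprS.
  rewrite enum_uniq -cardE cardF => /(_ isT); apply/negP; rewrite -leqNgt.
  apply: (@leq_trans (2 * q).+1); last by nia.
  have sz (c : F) i : (i <= 2 * q)%N -> (size (c *: 'X^i) <= (2 * q).+1)%N.
    by move=> le_i; apply: leq_trans (size_scale_leq _ _) _; rewrite size_polyXn.
  by do !(apply: leq_trans (size_polyD _ _) _; rewrite geq_max; apply/andP; split);
    apply: sz; lia.
have c i : P`_i = 0 by rewrite P0 coef0.
have ne : ((2 * q == q.+1) = false) * ((q.+1 == 2 * q) = false) * ((2 * q == q) = false)
    * ((q == 2 * q) = false) * ((2 * q == 2) = false) * ((2 == 2 * q) = false)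
    * ((2 * q == 1) = false) * ((1 == 2 * q) = false) * ((2 * q == 0) = false)
    * ((0 == 2 * q) = false) * ((q.+1 == q) = false) * ((q == q.+1) = false)
    * ((q.+1 == 2) = false) * ((2 == q.+1) = false) * ((q.+1 == 1) = false)
    * ((1 == q.+1) = false) * ((q.+1 == 0) = false) * ((0 == q.+1) = false)
    * ((q == 2) = false) * ((2 == q) = false) * ((q == 1) = false)
    * ((1 == q) = false) * ((q == 0) = false) * ((0 == q) = false)
  by do !split; lia.
have coefP i : P`_i = p5 * (i == 2 * q)%:R + p4 * (i == q.+1)%:R
    + p3 * (i == q)%:R + p2 * (i == 2)%:R + p1 * (i == 1)%:R + p0 * (i == 0)%:R.
  by rewrite /P !coefD !coefZ !coefXn.
split; [have := c (2 * q)%N|have := c q.+1|have := c q|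
  split; [have := c 2%N|have := c 1%N|have := c 0%N]];
  by rewrite coefP !(eqxx, ne) /= !(mulr1, mulr0, addr0, add0r).
Qed.

(** Additive Hilbert 90 with an explicit preimage; it provides a point of the variety above any
    given [(x, y)]. *)
Lemma antifixed_half c : conj c = - c -> conj (- c / 2%:R) - (- c / 2%:R) = c.
Proof.
move=> hc; rewrite rmorphM /= rmorphN /= hc fmorphV rmorph_nat.
by field.
Qed.

Definition herm x y : F := x * conj x + y * conj y.

(* [B_equation] at (1, x, y, z), with [al = alpha] and [de = beta ^+ q - beta]. *)
Definition affine_eq al de (x y z : F) :=
  conj (z + al * (x ^+ 2 + y ^+ 2)) - (z + al * (x ^+ 2 + y ^+ 2)) == de * herm x y.

(* The BM variety as a predicate on vectors; it also holds at the zero vector. *)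
Definition cone al de : pred 'rV[F]_4 := fun v =>
  if cJ v == 0 then herm (cX v) (cY v) == 0
  else affine_eq al de (cX v / cJ v) (cY v / cJ v) (cZ v / cJ v).

Lemma coneZ al de a v : a != 0 -> cone al de (a *: v) = cone al de v.
Proof.
move=> a0; rewrite /cone !hcoordE mulf_eq0 (negPf a0) /=.
case: eqP => [_|_]; last by rewrite !(mulrC a) -!mulf_div divff // !mulr1.
rewrite /herm !rmorphM /=; set X := cX v; set Y := cY v.
have -> : a * X * (conj a * conj X) + a * Y * (conj a * conj Y)
   = (a * conj a) * (X * conj X + Y * conj Y) by ring.
by rewrite mulf_eq0 mulf_eq0 fmorph_eq0 orbb (negPf a0).
Qed.

Lemma cone0 al de : cone al de 0.
Proof. by rewrite /cone hcoord0 eqxx /herm !hcoord0 !mul0r addr0. Qed.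

(** For a primitive element [z], the choice [om = z ^+ ((q - 1) / 2)] has norm
    [z ^+ ((q ^ 2 - 1) / 2) = -1], while [om ^+ 2 = z ^+ (q - 1)] has a smaller exponent and so is
    not -1. The direction [(1, om)] is isotropic for [herm] but not for [x ^+ 2 + y ^+ 2]. *)
Lemma exists_herm_isotropic :
  exists2 om : F, om * conj om = -1 & 1 + om ^+ 2 != 0.
Proof.
have [z zP] := finField_prim_root F; rewrite cardF in zP.
pose h := (q./2 * q.+1)%N.
have hn : (h * 2 = (q ^ 2).-1)%N by rewrite /h; have := odd_double_half q; nia.
have zh : z ^+ h = -1.
  have : (z ^+ h) ^+ 2 == 1 by rewrite -exprM hn (prim_expr_order zP).
  rewrite sqrf_eq1 => /orP[|/eqP //].
  by rewrite -(prim_order_dvd zP) => /dvdn_leq; rewrite /h; nia.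
exists (z ^+ q./2); first by rewrite conjE -exprS -exprM.
rewrite addrC -[1]opprK subr_eq0 -zh -exprM (eq_prim_root_expr zP).
by rewrite !modn_small; move: hn; rewrite /h; have := odd_double_half q; nia.
Qed.

(** * Lines contained in the variety and the characterisation of its vertex *)

Section Lines.
Variables (al de : F).
Hypotheses (al_neq0 : al != 0) (de_neq0 : de != 0) (conj_de : conj de = - de).

(** The equation along [v + s *: r] is a polynomial in [s] and [conj s]. The conditions on [r] are
    the vanishing of its coefficients at [s ^+ 2], [s * conj s] and [s]; those at [conj s ^+ 2] and
    [conj s] are conjugate to these up to sign, as [conj de = - de]. *)
Lemma cone_affine_lineP v r : cJ v = 1 -> cJ r = 0 ->
    (forall s, cone al de (v + s *: r)) <->
  [/\ cone al de v, cX r ^+ 2 + cY r ^+ 2 = 0, herm (cX r) (cY r) = 0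
    & cZ r = - (2%:R * al * (cX r * cX v + cY r * cY v)
               + de * (cX r * conj (cX v) + cY r * conj (cY v)))].
Proof.
move=> Jv Jr.
have cone_s s : cone al de (v + s *: r)
    = affine_eq al de (cX v + s * cX r) (cY v + s * cY r) (cZ v + s * cZ r).
  by rewrite /cone !hcoordE Jv Jr mulr0 addr0 oner_eq0 !divr1.
have cone_v : cone al de v = affine_eq al de (cX v) (cY v) (cZ v).
  by rewrite /cone Jv oner_eq0 !divr1.
rewrite cone_v {cone_v}.
move: (cX v) (cY v) (cZ v) (cX r) (cY r) (cZ r) cone_s => x y z a b c cone_s.
split=> [H|[/eqP Hv A0 n0 c_eq] s].
  have Hv : affine_eq al de x y z.
    by have := H 0; rewrite cone_s !mul0r !addr0.
  have [s|_ n0 _ [A0 c0 _]] := @conj_poly_eq0 (conj al * (conj a ^+ 2 + conj b ^+ 2))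
    (- (de * herm a b))
    (conj (c + 2%:R * al * (a * x + b * y)) - de * (x * conj a + y * conj b))
    (- (al * (a ^+ 2 + b ^+ 2)))
    (- (c + 2%:R * al * (a * x + b * y)) - de * (a * conj x + b * conj y))
    (conj (z + al * (x ^+ 2 + y ^+ 2)) - (z + al * (x ^+ 2 + y ^+ 2)) - de * herm x y).
    have := H s; rewrite cone_s /affine_eq -subr_eq0 => /eqP <-.
    by rewrite /herm; ring.
  split=> //.
  - by apply/eqP; move/eqP: A0; rewrite oppr_eq0 mulf_eq0 (negPf al_neq0).
  - by apply/eqP; move/eqP: n0; rewrite oppr_eq0 mulf_eq0 (negPf de_neq0).
  by apply: subr0_eq; rewrite -[RHS]oppr0 -c0; ring.
rewrite cone_s /affine_eq.
have -> : z + s * c + al * ((x + s * a) ^+ 2 + (y + s * b) ^+ 2)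
  = z + al * (x ^+ 2 + y ^+ 2) + al * s ^+ 2 * (a ^+ 2 + b ^+ 2)
    - s * de * (a * conj x + b * conj y) by rewrite c_eq; ring.
rewrite A0 mulr0 addr0 -subr_eq0.
have -> : herm (x + s * a) (y + s * b) = herm x y + s * (a * conj x + b * conj y)
   + conj s * (x * conj a + y * conj b) + s * conj s * herm a b.
  by rewrite /herm; ring.
rewrite n0 mulr0 addr0; apply/eqP; rewrite -[RHS](subrr (de * herm x y)) -{1}Hv.
rewrite !(rmorphD, rmorphN, rmorphM, rmorphXn) /= !conjK conj_de.
by ring.
Qed.

Lemma cone_infinity v : cJ v = 0 -> cone al de v = (herm (cX v) (cY v) == 0).
Proof. by move=> Jv; rewrite /cone Jv eqxx. Qed.

Lemma herm_scale s a b : herm a b = 0 -> herm (s * a) (s * b) = 0.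
Proof.
move=> h; transitivity (s * conj s * herm a b); last by rewrite h mulr0.
by rewrite /herm; ring.
Qed.

Lemma line_in_cone_affine v r : cJ v = 1 -> cJ r = 0 ->
  (forall s, cone al de (v + s *: r)) -> line_in (cone al de) v r.
Proof.
move=> Jv Jr H a b; have [->|a0] := eqVneq a 0.
  have [_ _ h _] := (cone_affine_lineP Jv Jr).1 H.
  by rewrite scale0r add0r cone_infinity !hcoordE ?Jr ?mulr0 // herm_scale.
have -> : a *: v + b *: r = a *: (v + (b / a) *: r).
  by rewrite scalerDr scalerA mulrC divfK.
by rewrite coneZ.
Qed.

Lemma sum_sqr_eq0 a b : a ^+ 2 + b ^+ 2 = 0 :> F -> (a == 0) = (b == 0).
Proof.
move/eqP; rewrite addr_eq0 => /eqP A.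
by rewrite -sqrf_eq0 A oppr_eq0 sqrf_eq0.
Qed.

(** Isotropy for [x ^+ 2 + y ^+ 2] makes [cX r] and [cY r] vanish together, and then so does [cZ r].
    In particular no line of the variety with an affine point passes through [(0, 0, 0, 1)]. *)
Lemma cone_affine_line_dir_neq0 v r : cJ v = 1 -> cJ r = 0 ->
    (forall s, cone al de (v + s *: r)) -> r != 0 ->
  cX r != 0 /\ cY r != 0.
Proof.
move=> Jv Jr /(cone_affine_lineP Jv Jr)[_ A _ c_eq] r0.
have [X0|X0] := boolP (cX r == 0); last by rewrite -(sum_sqr_eq0 A).
have Y0 : cY r == 0 by rewrite -(sum_sqr_eq0 A).
case/eqP: r0; apply: eq_coord; rewrite ?hcoord0 ?(eqP X0) ?(eqP Y0) //.
by rewrite c_eq (eqP X0) (eqP Y0) !mul0r !addr0 !mulr0 addr0 oppr0.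
Qed.

(** Otherwise Cramer's rule yields a point of the line with [(X, Y) = (1, 0)], where [herm] is 1.
    Hence lines of the variety at infinity pass through the vertex. *)
Lemma line_in_cone_infinity v w : cJ v = 0 -> cJ w = 0 ->
  line_in (cone al de) v w -> cX v * cY w = cX w * cY v.
Proof.
move=> Jv Jw H; apply/eqP; rewrite -subr_eq0; apply/negPn/negP=> D0.
set D := _ - _ in D0.
have := H (cY w / D) (- (cY v / D)); rewrite cone_infinity !hcoordE ?Jv ?Jw ?mulr0 ?addr0 //.
have -> : cY w / D * cX v + - (cY v / D) * cX w = 1.
  by rewrite /D; field.
have -> : cY w / D * cY v + - (cY v / D) * cY w = 0 by ring.
by rewrite /herm rmorph1 mul0r addr0 mulr1 oner_eq0.
Qed.

Lemma line_in_cone_vertex z u : cJ u = 0 -> herm (cX u) (cY u) = 0 ->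
  line_in (cone al de) (vec4 0 0 0 z) u.
Proof.
move=> Ju hu a b; rewrite cone_infinity !hcoordE !vec4E ?Ju !mulr0 ?addr0 ?add0r //.
by rewrite herm_scale.
Qed.

(** The line towards [(0, 1, om, 0)] works: a second line through one of its points either stays at
    infinity, hence contains the vertex, or is affine with direction [(1, om)], contradicting
    [1 + om ^+ 2 != 0]. *)
Lemma isolated_line_point_vertex : isolated_line_point (cone al de) (vec4 0 0 0 1).
Proof.
have [om om_h om_A] := exists_herm_isotropic.
exists (vec4 0 1 om 0); split.
- move=> a; apply/eqP=> /(congr1 (@cX F)).
  by rewrite hcoordE !vec4E mulr0 => /eqP; rewrite oner_eq0.
- by apply: line_in_cone_vertex; rewrite !vec4E // /herm rmorph1 mulr1 om_h subrr.
move=> s u H; set w := _ + _ in H.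
have Jw : cJ w = 0 by rewrite /w !hcoordE !vec4E mulr0 addr0.
have Xw : cX w = 1 by rewrite /w !hcoordE !vec4E mulr0 addr0.
have Yw : cY w = om by rewrite /w !hcoordE !vec4E mulr0 addr0.
have [Ju|Ju] := eqVneq (cJ u) 0.
  have := line_in_cone_infinity Jw Ju H; rewrite Xw Yw mul1r => Yu.
  exists (cZ u), (cX u); apply: eq_coord; rewrite !hcoordE !vec4E ?Ju ?Yu; ring.
have Jv : cJ ((cJ u)^-1 *: u) = 1 by rewrite hcoordE mulVf.
have /(cone_affine_lineP Jv Jw)[_] : forall t, cone al de ((cJ u)^-1 *: u + t *: w).
  by move=> t; rewrite addrC; apply: H.
by rewrite Xw Yw expr1n => /eqP; rewrite (negPf om_A).
Qed.

(* A line of the cone with an affine point has direction (0, a, b, c) with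
   [b ^+ 2 = - a ^+ 2], and each of its affine points lies on a second line, of
   direction (0, a, - b, c'), while its point at infinity lies on a line through
   the vertex. *)
Lemma isolated_line_pointP v : isolated_line_point (cone al de) v ->
  [/\ cJ v = 0, cX v = 0 & cY v = 0].
Proof.
case=> w [w_v vw_cone uniq_line].
have [Jv|Jv] := eqVneq (cJ v) 0; last first.
  (* [P] is the affine normalisation of [v], and [r] the point at infinity of the line; uniqueness
     is contradicted at [r] by the line joining it to the vertex. *)
  pose P := (cJ v)^-1 *: v; pose r := w - cJ w *: P.
  have JP : cJ P = 1 by rewrite hcoordE mulVf.
  have Jr : cJ r = 0 by rewrite hcoordD hcoordN hcoordZ JP mulr1 subrr.
  have r0 : r != 0 by rewrite subr_eq0 scalerA w_v.
  have Pr s : cone al de (P + s *: r).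
    have -> : P + s *: r = ((cJ v)^-1 - s * cJ w / cJ v) *: v + s *: w.
      by rewrite /r /P; apply: eq_coord; rewrite !hcoordE; ring.
    exact: vw_cone.
  have [Xr Yr] := cone_affine_line_dir_neq0 JP Jr Pr r0.
  have [_ _ hr _] := (cone_affine_lineP JP Jr).1 Pr.
  have [] := uniq_line (- (cJ w / cJ v)) (vec4 0 0 0 1).
    have -> : w + - (cJ w / cJ v) *: v = r by rewrite scaleNr /r /P scalerA.
    move=> a b; rewrite addrC; exact: line_in_cone_vertex.
  move=> a [b e]; have bX : b * cX r = 0.
    have eJ : 0 = a * cJ v + b * cJ w by rewrite -!hcoordE -e vec4E.
    have -> : 0 = a * cX v + b * cX w by rewrite -!hcoordE -e vec4E.
    apply: (mulfI Jv); rewrite /r /P !hcoordE.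
    transitivity (b * (cX w * cJ v) - (b * cJ w) * cX v); first by field.
    by rewrite (_ : b * cJ w = - (a * cJ v)); [ring | apply/eqP; rewrite -addr_eq0 addrC -eJ].
  move/eqP: bX; rewrite mulf_eq0 (negPf Xr) orbF => /eqP b0.
  move: e; rewrite b0 scale0r addr0 => e.
  have /eqP := congr1 (@cJ F) e; rewrite hcoordE vec4E eq_sym mulf_eq0 (negPf Jv) orbF.
  move=> /eqP a0; have := congr1 (@cZ F) e; rewrite hcoordE vec4E a0 mul0r => /eqP.
  by rewrite oner_eq0.
have [Jw|Jw] := eqVneq (cJ w) 0.
  have [XY0|XY0] := boolP ((cX v == 0) && (cY v == 0)).
    by case/andP: XY0 => /eqP -> /eqP ->.
  have D := line_in_cone_infinity Jv Jw vw_cone.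
  have [k Xw Yw] : exists2 k, cX w = k * cX v & cY w = k * cY v.
    move: XY0; rewrite negb_and; case: eqVneq => [X0 Y0|X0 _]; last first.
      by exists (cX w / cX v); rewrite ?divfK // mulrAC -D mulrAC divff ?mul1r.
    exists (cY w / cY v); rewrite ?divfK //; apply: (mulIf Y0).
    by rewrite -D X0 !(mul0r, mulr0).
  have [om om_h _] := exists_herm_isotropic.
  (* [w - k *: v] is a multiple of the vertex, through which every isotropic direction [(1, t)]
     gives a line of the variety. Uniqueness forces [v] to have slope [t], for both [t = om] and
     [t = - om]. *)
  have slope t : herm 1 t = 0 -> cX v != 0 /\ cY v = t * cX v.
    move=> ht; have [] := uniq_line (- k) (vec4 0 1 t 0).
      have -> : w + - k *: v = vec4 0 0 0 (cZ w - k * cZ v).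
        by apply: eq_coord; rewrite !hcoordE !vec4E ?Jv ?Jw ?Xw ?Yw; ring.
      by apply: line_in_cone_vertex; rewrite !vec4E.
    move=> a [b e]; have := congr1 (@cX F) e; have := congr1 (@cY F) e.
    rewrite !hcoordE !vec4E Xw Yw !mulrA -!mulrDl => eY eX.
    have X0 : cX v != 0.
      by apply/eqP=> X0; move/eqP: eX; rewrite X0 mulr0 oner_eq0.
    split=> //; rewrite eY mulrAC -eX mul1r //.
  have [X0 Y1] : cX v != 0 /\ cY v = om * cX v.
    by apply: slope; rewrite /herm rmorph1 mulr1 om_h subrr.
  have [_ Y2] : cX v != 0 /\ cY v = - om * cX v.
    by apply: slope; rewrite /herm rmorph1 rmorphN mulr1 mulrNN om_h subrr.
  have om0 : om != 0.
    by apply/eqP=> om0; move/eqP: om_h; rewrite om0 mul0r eq_sym oppr_eq0 oner_eq0.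
  have /eqP : 2%:R * (om * cX v) = 0.
    by rewrite -[RHS](subrr (cY v)) {1}Y1 Y2; ring.
  by rewrite !mulf_eq0 (negPf two_neq0) (negPf om0) (negPf X0).
pose P := (cJ w)^-1 *: w.
have JP : cJ P = 1 by rewrite hcoordE mulVf.
have Pv s : cone al de (P + s *: v) by rewrite addrC; apply: vw_cone.
have [v0|v0] := eqVneq v 0; first by rewrite v0 !hcoord0.
have [Xv Yv] := cone_affine_line_dir_neq0 JP Jv Pv v0.
have [P_cone A hv _] := (cone_affine_lineP JP Jv).1 Pv.
(* The reflected direction keeps both forms zero; its last coordinate is the one prescribed by
   [cone_affine_lineP]. *)
pose u := vec4 0 (cX v) (- cY v) (- (2%:R * al * (cX v * cX P - cY v * cY P)
               + de * (cX v * conj (cX P) - cY v * conj (cY P)))).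
have Ju : cJ u = 0 by rewrite vec4E.
have Pu s : cone al de (P + s *: u).
  move: s; apply/(cone_affine_lineP JP Ju); rewrite !vec4E sqrrN; split=> //.
    by rewrite -[RHS]hv /herm rmorphN; ring.
  by ring.
have [] := uniq_line 0 u.
  move=> a b; rewrite scale0r addr0.
  have -> : a *: w = (a * cJ w) *: P by rewrite scalerA mulfK.
  exact: line_in_cone_affine.
move=> a [b e]; have := congr1 (@cJ F) e; rewrite !hcoordE vec4E Jv mulr0 add0r.
move=> /esym/eqP; rewrite mulf_eq0 (negPf Jw) orbF => /eqP b0.
move: e; rewrite b0 scale0r addr0 => e.
have := congr1 (@cX F) e; have := congr1 (@cY F) e; rewrite !hcoordE !vec4E.
move=> eY eX; case/eqP: Yv; apply: (mulfI two_neq0); rewrite mulr0.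
have -> : 2%:R * cY v = cY v - - cY v by ring.
by rewrite eY; apply: (mulfI Xv); rewrite mulr0 mulrBr mulrA (mulrC _ a) -eX subrr.
Qed.

End Lines.


(** * The invariant of an equivalence written in affine coordinates *)

Section Invariant.
Variables (sig : {rmorphism F -> F}) (al de al' de' : F).
Hypotheses (al'_neq0 : al' != 0) (de'_neq0 : de' != 0).
Hypotheses (al_neq0 : al != 0) (de_neq0 : de != 0) (conj_de : conj de = - de).

Let sig_conj x : sig (conj x) = conj (sig x).
Proof. by rewrite !conjE rmorphXn. Qed.

Lemma finField_rmorph_surj x : exists y, sig y = x.
Proof.
by have [g _ gK] := injF_bij (fmorph_inj sig); exists (g x); rewrite gK.
Qed.

Variables (x0 y0 z0 b11 b12 b21 b22 l1 l2 mu : F).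
Hypothesis mu_neq0 : mu != 0.
Hypothesis affine_map : forall x y z, affine_eq al de x y z ->
  affine_eq al' de' (x0 + (sig x * b11 + sig y * b21))
    (y0 + (sig x * b12 + sig y * b22)) (z0 + (sig x * l1 + sig y * l2) + sig z * mu).

(** The points [(0, 0, 0)] and [(0, 0, 1)] lie on the variety, and their images differ only by [mu]
    in the last coordinate. *)
Lemma affine_map_conj : conj mu = mu.
Proof.
have aff0 z : conj z = z -> affine_eq al de 0 0 z.
  by move=> zz; rewrite /affine_eq /herm expr0n /= !(mul0r, mulr0, addr0) zz subrr.
have := affine_map (aff0 0 (rmorph0 _)); have := affine_map (aff0 1 (rmorph1 _)).
rewrite /affine_eq !rmorph0 rmorph1 !(mul0r, mul1r, addr0) => /eqP <- /eqP e.
apply: subr0_eq; move/eqP: e; rewrite -subr_eq0 => /eqP e.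
by rewrite -[RHS]oppr0 -e; ring.
Qed.

Lemma affine_rhs_antifixed (x y w : F) :
  conj (de * herm x y - (conj w - w)) = - (de * herm x y - (conj w - w)).
Proof.
by rewrite /herm !(rmorphB, rmorphM, rmorphD) /= !conjK conj_de; ring.
Qed.

(** Above each point of the line spanned by a direction [(a, b)] there is a point of the variety.
    Its image satisfies an equation polynomial in the parameter and its conjugate, whose
    coefficients at [s ^+ 2] and [s * conj s] are the two similitude relations. *)
Lemma affine_map_forms A B :
  (al' * ((A * b11 + B * b21) ^+ 2 + (A * b12 + B * b22) ^+ 2)
     = mu * sig al * (A ^+ 2 + B ^+ 2)) *
  (de' * herm (A * b11 + B * b21) (A * b12 + B * b22) = mu * sig de * herm A B).
Proof.
have [a <-] := finField_rmorph_surj A; have [b <-] := finField_rmorph_surj B.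
set x1 := sig a * b11 + _; set y1 := sig a * b12 + _.
pose l := sig a * l1 + sig b * l2.
pose sQ := sig al * (sig a ^+ 2 + sig b ^+ 2).
have [s| _ h4 _ [h2 _ _]] := @conj_poly_eq0
  (conj al' * (conj x1 ^+ 2 + conj y1 ^+ 2) - mu * conj sQ)
  (mu * sig de * herm (sig a) (sig b) - de' * herm x1 y1)
  (conj l + 2%:R * conj al' * (conj x0 * conj x1 + conj y0 * conj y1)
     - de' * (x0 * conj x1 + y0 * conj y1))
  (mu * sQ - al' * (x1 ^+ 2 + y1 ^+ 2))
  (- (l + 2%:R * al' * (x0 * x1 + y0 * y1)) - de' * (x1 * conj x0 + y1 * conj y0))
  (conj (z0 + al' * (x0 ^+ 2 + y0 ^+ 2)) - (z0 + al' * (x0 ^+ 2 + y0 ^+ 2))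
    - de' * herm x0 y0).
  have [t <-] := finField_rmorph_surj s.
  pose Q := al * ((t * a) ^+ 2 + (t * b) ^+ 2).
  (* The value that [conj z - z] must take for [(t * a, t * b, z)] to lie on the variety. *)
  pose c := de * herm (t * a) (t * b) - (conj Q - Q).
  have cc : conj c = - c by apply: affine_rhs_antifixed.
  pose z := - c / 2%:R; have zc : conj z - z = c by apply: antifixed_half.
  have zaff : affine_eq al de (t * a) (t * b) z.
    rewrite /affine_eq -/Q rmorphD /= -subr_eq0; apply/eqP.
    by rewrite -[RHS](subrr c) -{1}zc /c; ring.
  have := affine_map zaff; rewrite /affine_eq -subr_eq0 => /eqP <-.
  have zc' : mu * (conj (sig z) - sig z) = mu * sig c.
    by rewrite -sig_conj -rmorphB zc.
  have cE : sig c = sig de * (sig t * conj (sig t)) * herm (sig a) (sig b)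
        - (conj (sig t) ^+ 2 * conj sQ - sig t ^+ 2 * sQ).
    rewrite /c /Q /sQ /herm.
    rewrite !(rmorphB, rmorphM, rmorphD, rmorphXn, sig_conj) /=; ring.
  (* As [mu] is fixed by [conj], the equation sees [w] only through [conj w - w], which is known for
     [w = sig z]. *)
  have push (u v w : F) : conj (u + w * mu + v) - (u + w * mu + v)
      = mu * (conj w - w) + (conj (u + v) - (u + v)).
    by rewrite !rmorphD rmorphM /= affine_map_conj; ring.
  rewrite push zc' cE /x1 /y1 /l /herm !(rmorphM sig); ring.
split; first by apply/esym; apply: subr0_eq; rewrite -h2 /sQ; ring.
by apply/esym; apply: subr0_eq; rewrite -h4.
Qed.

(* Writing B for the linear part [b_ij], the forms give [B B^T = c I] and
   [B conj(B)^T = d I], which forces [c * conj c = d ^+ 2]. *)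
Lemma affine_map_invariant :
  al' * conj al' / de' ^+ 2 = sig (al * conj al / de ^+ 2).
Proof.
set c := mu * sig al / al'; set d := mu * sig de / de'.
have forms A B : ((A * b11 + B * b21) ^+ 2 + (A * b12 + B * b22) ^+ 2
     = c * (A ^+ 2 + B ^+ 2)) *
  (herm (A * b11 + B * b21) (A * b12 + B * b22) = d * herm A B).
  have [e1 e2] := affine_map_forms A B.
  split; [apply: (mulfI al'_neq0); rewrite e1 /c | apply: (mulfI de'_neq0); rewrite e2 /d];
  by field.
have c_neq0 : c != 0 by rewrite !mulf_neq0 ?invr_neq0 // fmorph_eq0.
have [e10 h10] := forms 1 0; have [e01 _] := forms 0 1; have [e11 h11] := forms 1 1.
have [_ hde] := forms 1 de; have [_ h01] := forms 0 1.
have orth : b11 * b21 + b12 * b22 = 0.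
  apply: (mulfI two_neq0); rewrite mulr0.
  rewrite -[RHS](subrr (c * (1 ^+ 2 + 1 ^+ 2))) -{1}e11.
  have -> : c * (1 ^+ 2 + 1 ^+ 2) = c * (1 ^+ 2 + 0 ^+ 2) + c * (0 ^+ 2 + 1 ^+ 2) by ring.
  by rewrite -e10 -e01; ring.
(* Polarising the Hermitian relation at [u = 1] gives [conj W = - W], and at the antifixed [u = de]
   gives [conj W = W]; so [W = 0] in odd characteristic. *)
pose W := b11 * conj b21 + b12 * conj b22.
have W_u u : herm (1 * b11 + u * b21) (1 * b12 + u * b22) = d * herm 1 u ->
    conj u * W + u * conj W = 0.
  move=> hu; rewrite -[RHS](subrr (d * herm 1 u)) -{1}hu.
  have -> : d * herm 1 u = d * herm 1 0 + u * conj u * (d * herm 0 1).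
    by rewrite /herm !rmorph0 rmorph1; ring.
  rewrite -h10 -h01 /W /herm !(rmorphD, rmorphM, rmorph0, rmorph1) /= !conjK.
  by ring.
have W0 : W = 0.
  have := W_u _ h11; rewrite rmorph1 !mul1r => /eqP; rewrite addr_eq0 => /eqP W1.
  have := W_u _ hde; rewrite conj_de mulNr {1}W1 mulrN opprK -mulr2n -mulr_natl.
  move/eqP; rewrite !mulf_eq0 (negPf two_neq0) (negPf de_neq0) /= => /eqP W2.
  by rewrite W1 W2 oppr0.
have W0' : conj b11 * conj b21 + conj b12 * conj b22 = 0.
  by rewrite -!rmorphM -rmorphD orth rmorph0.
(* By Lagrange's identity [c * conj c - d ^+ 2 = m ^+ 2]. Both orthogonality relations together make
   [m] annihilate the conjugated second row, which is nonzero since its squares sum to [conj c]. *)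
pose m := b11 * conj b12 - b12 * conj b11.
have [m1 m2] : conj b21 * m = 0 /\ conj b22 * m = 0.
  split.
    transitivity (W * conj b12 - b12 * (conj b11 * conj b21 + conj b12 * conj b22)).
      by rewrite /W /m; ring.
    by rewrite W0 W0' mul0r mulr0 subrr.
  transitivity (b11 * (conj b11 * conj b21 + conj b12 * conj b22) - W * conj b11).
    by rewrite /W /m; ring.
  by rewrite W0 W0' mul0r mulr0 subrr.
have m0 : m = 0.
  apply/eqP/negPn/negP=> m_neq0.
  move/eqP: m1; move/eqP: m2; rewrite !mulf_eq0 (negPf m_neq0) !orbF !fmorph_eq0.
  move=> /eqP b22_0 /eqP b21_0; case/eqP: c_neq0.
  transitivity (c * (0 ^+ 2 + 1 ^+ 2)); first by ring.
  by rewrite -e01 b22_0 b21_0; ring.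
have cd : c * conj c = d ^+ 2.
  have -> : c = b11 ^+ 2 + b12 ^+ 2.
    by transitivity (c * (1 ^+ 2 + 0 ^+ 2)); [ring | rewrite -e10; ring].
  have -> : d = herm b11 b12.
    transitivity (d * herm 1 0); first by rewrite /herm rmorph0 rmorph1; ring.
    by rewrite -h10; congr herm; ring.
  apply: subr0_eq; transitivity (m ^+ 2); last by rewrite m0 expr0n.
  by rewrite /m /herm !(rmorphD, rmorphXn) /=; ring.
have conj_sig_al : conj (sig al) = sig (conj al) by rewrite sig_conj.
have conj_al'_neq0 : conj al' != 0 by rewrite fmorph_eq0.
have sig_de_neq0 : sig de != 0 by rewrite fmorph_eq0.
have conj_c : conj c = mu * sig (conj al) / conj al'.
  by rewrite /c fmorph_div rmorphM /= affine_map_conj conj_sig_al.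
rewrite conj_c /c /d in cd.
rewrite fmorph_div rmorphM rmorphXn /=.
have -> : sig al * sig (conj al) = mu * sig al / al' * (mu * sig (conj al) / conj al')
   * (al' * conj al') / mu ^+ 2.
  by field; rewrite al'_neq0 conj_al'_neq0 mu_neq0.
rewrite cd; field; by rewrite de'_neq0 sig_de_neq0 mu_neq0.
Qed.

End Invariant.

(** * Semilinear equivalences fix the vertex and the plane at infinity *)

Section Transfer.
Variables (sig : {rmorphism F -> F}) (psi : 'rV[F]_4 -> 'rV[F]_4).
Hypotheses (psiD : {morph psi : v w / v + w})
  (psiZ : forall a v, psi (a *: v) = sig a *: psi v) (psi_inj : injective psi).

Let psi_surj v : exists u, psi u = v.
Proof. by have [g _ gK] := injF_bij psi_inj; exists (g v); rewrite gK. Qed.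

Let psi0 : psi 0 = 0.
Proof. by have := psiZ 0 0; rewrite rmorph0 !scale0r. Qed.

Lemma semilinear_line_in (M M' : pred 'rV[F]_4) v w :
  (forall u, M u = M' (psi u)) -> line_in M v w <-> line_in M' (psi v) (psi w).
Proof.
move=> MM'; split=> H a b; last by rewrite MM' psiD !psiZ.
have [a' <-] := finField_rmorph_surj sig a.
have [b' <-] := finField_rmorph_surj sig b.
by rewrite -!psiZ -psiD -MM'; apply: H.
Qed.

Lemma semilinear_isolated_line_point (M M' : pred 'rV[F]_4) v :
  (forall u, M u = M' (psi u)) ->
  isolated_line_point M v -> isolated_line_point M' (psi v).
Proof.
move=> MM' [w [w_v vw uniq]]; exists (psi w); split.
- move=> a; have [b <-] := finField_rmorph_surj sig a.
  by rewrite -psiZ (inj_eq psi_inj).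
- exact/(semilinear_line_in v w MM').
move=> s u'; have [t <-] := finField_rmorph_surj sig s.
have [u <-] := psi_surj u'; rewrite -psiZ -psiD => /(semilinear_line_in _ _ MM').
by move=> /uniq[a [b ->]]; exists (sig a), (sig b); rewrite psiD !psiZ.
Qed.

Variables (al de al' de' : F).
Hypotheses (al_neq0 : al != 0) (de_neq0 : de != 0) (conj_de : conj de = - de).
Hypotheses (al'_neq0 : al' != 0) (de'_neq0 : de' != 0) (conj_de' : conj de' = - de').
Hypothesis cone_psi : forall v, cone al de v = cone al' de' (psi v).

(** The vertex [e4] is fixed, being the only isolated line point. Lines through it go to lines
    through it, hence stay at infinity; the slopes [om] and [- om] together with [e4] span the plane
    [J = 0], so [psi] is affine and [affine_map_invariant] applies. *)
Lemma cone_semilinear_invariant :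
  al' * conj al' / de' ^+ 2 = sig (al * conj al / de ^+ 2).
Proof.
pose e1 : 'rV[F]_4 := vec4 1 0 0 0; pose e2 : 'rV[F]_4 := vec4 0 1 0 0.
pose e3 : 'rV[F]_4 := vec4 0 0 1 0; pose e4 : 'rV[F]_4 := vec4 0 0 0 1.
have [J4 X4 Y4] : [/\ cJ (psi e4) = 0, cX (psi e4) = 0 & cY (psi e4) = 0].
  apply: (isolated_line_pointP al'_neq0 de'_neq0 conj_de').
  by apply: (semilinear_isolated_line_point cone_psi); apply: isolated_line_point_vertex.
have Z4 : cZ (psi e4) != 0.
  apply: contra_neq (oner_neq0 F) => Z0; have : psi e4 = psi 0.
    by rewrite psi0; apply: eq_coord; rewrite hcoord0.
  by move/psi_inj/(congr1 (@cZ F)); rewrite vec4E hcoord0.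
have psi4 : psi e4 != 0 by apply: contra_neq Z4 => ->; rewrite hcoord0.
have inf t : herm 1 t = 0 -> cJ (psi (vec4 0 1 t 0)) = 0.
  move=> ht; set u := vec4 0 1 t 0.
  have /(semilinear_line_in _ _ cone_psi) H : line_in (cone al de) e4 u.
    by apply: line_in_cone_vertex; rewrite !vec4E.
  apply/eqP/negPn/negP=> Ju.
  have JP : cJ ((cJ (psi u))^-1 *: psi u) = 1 by rewrite hcoordE mulVf.
  have Hs s : cone al' de' ((cJ (psi u))^-1 *: psi u + s *: psi e4).
    by rewrite addrC; apply: H.
  have [] := cone_affine_line_dir_neq0 al'_neq0 de'_neq0 conj_de' JP J4 Hs psi4.
  by rewrite X4 eqxx.
have [om om_h _] := exists_herm_isotropic.
have J_om : cJ (psi (vec4 0 1 om 0)) = 0.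
  by apply: inf; rewrite /herm rmorph1 mulr1 om_h subrr.
have J_om' : cJ (psi (vec4 0 1 (- om) 0)) = 0.
  by apply: inf; rewrite /herm rmorph1 rmorphN mulr1 mulrNN om_h subrr.
have om0 : om != 0.
  by apply/eqP=> om0; move/eqP: om_h; rewrite om0 mul0r eq_sym oppr_eq0 oner_eq0.
have J2 : cJ (psi e2) = 0.
  have -> : e2 = 2%:R^-1 *: (vec4 0 1 om 0 + vec4 0 1 (- om) 0).
    by apply: eq_coord; rewrite !hcoordE !vec4E; field.
  by rewrite psiZ psiD !hcoordE J_om J_om' addr0 mulr0.
have J3 : cJ (psi e3) = 0.
  have -> : e3 = om^-1 *: (vec4 0 1 om 0 - e2).
    by apply: eq_coord; rewrite !hcoordE !vec4E; field.
  by rewrite psiZ -[- e2]scaleN1r psiD psiZ !hcoordE J_om J2 mulr0 addr0 mulr0.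
have psiE j x y z : psi (vec4 j x y z)
    = sig j *: psi e1 + sig x *: psi e2 + sig y *: psi e3 + sig z *: psi e4.
  rewrite -!psiZ -!psiD; congr psi.
  by apply: eq_coord; rewrite !hcoordE !vec4E; ring.
(* With [k = 0] the image of [psi] would lie in [J = 0]. Dividing by [k] brings images of affine
   points to [J = 1]. *)
pose k := cJ (psi e1); have k0 : k != 0.
  apply/eqP=> k0; have [v v_e1] := psi_surj e1.
  have v4 : v = vec4 (cJ v) (cX v) (cY v) (cZ v) by apply: eq_coord; rewrite vec4E.
  have := congr1 (@cJ F) v_e1.
  rewrite v4 psiE !hcoordE -/k k0 J2 J3 J4 !mulr0 !addr0 vec4E => /esym/eqP.
  by rewrite oner_eq0.
apply: (@affine_map_invariant sig al de al' de' al'_neq0 de'_neq0 al_neq0 de_neq0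
  conj_de (cX (psi e1) / k) (cY (psi e1) / k) (cZ (psi e1) / k)
  (cX (psi e2) / k) (cY (psi e2) / k) (cX (psi e3) / k) (cY (psi e3) / k)
  (cZ (psi e2) / k) (cZ (psi e3) / k) (cZ (psi e4) / k)).
  by rewrite mulf_neq0 ?invr_eq0.
move=> x y z.
have -> : affine_eq al de x y z = cone al de (vec4 1 x y z).
  by rewrite /cone !vec4E oner_eq0 !divr1.
rewrite cone_psi psiE rmorph1 /cone !hcoordE -/k J2 J3 J4 X4 Y4 !mulr0 !addr0 mul1r.
rewrite (negPf k0) !mul1r => H; apply: etrans H; congr affine_eq; by field.
Qed.

End Transfer.

(** * Equal invariants up to an automorphism yield an equivalence *)

Section Construction.
Variables (sig : {rmorphism F -> F}) (al de al' de' : F).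
Hypotheses (al_neq0 : al != 0) (de_neq0 : de != 0) (conj_de : conj de = - de).
Hypotheses (de'_neq0 : de' != 0) (conj_de' : conj de' = - de').

Lemma affine_eq_rmorph x y z :
  affine_eq al de x y z = affine_eq (sig al) (sig de) (sig x) (sig y) (sig z).
Proof.
rewrite /affine_eq /herm -[LHS](inj_eq (fmorph_inj sig)).
rewrite !(rmorphB sig, rmorphD sig, rmorphM sig, rmorphXn sig) /= !conjE.
by rewrite !(rmorphXn sig) !(rmorphD sig, rmorphM sig, rmorphXn sig).
Qed.

(* Comparing the two equations forces [mu * al = al' * lam ^+ 2] and
   [mu * de = de' * (lam * conj lam)], hence [conj lam / lam = al' * de / (al * de')]. *)
Lemma affine_eq_diag : al' * conj al' / de' ^+ 2 = al * conj al / de ^+ 2 ->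
  exists lam mu : F, [/\ lam != 0, mu != 0
    & forall x y z, affine_eq al de x y z = affine_eq al' de' (lam * x) (lam * y) (mu * z)].
Proof.
move=> inv; have cal : conj al != 0 by rewrite fmorph_eq0.
pose rho := al' * de / (al * de').
(* The norm of [rho] is the quotient of the two invariants; Hilbert 90 then gives [lam] with
   [conj lam = lam * rho]. *)
have rho_norm : rho ^+ q.+1 = 1.
  rewrite exprS -conjE /rho fmorph_div !rmorphM /= conj_de conj_de'.
  transitivity ((al' * conj al' / de' ^+ 2) * (de ^+ 2 / (al * conj al))).
    by field; rewrite !(oppr_eq0, de'_neq0, cal, al_neq0).
  by rewrite inv; field; rewrite !(cal, al_neq0, de_neq0).
have q1 : (#|F|.-1 = q.-1 * q.+1)%N by rewrite cardF; nia.
have [|lam lam0] := finField_root_of_unity _ rho_norm; first by rewrite q1 dvdn_mull.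
rewrite q1 mulnK // => rhoE.
have conj_lam : conj lam = lam * rho.
  by rewrite rhoE -exprS prednK ?conjE //; lia.
pose mu := de' * (lam * conj lam) / de.
have clam : conj lam != 0 by rewrite fmorph_eq0.
have mu0 : mu != 0 by rewrite !mulf_neq0 ?invr_neq0.
(* Since [mu] lies in GF(q), it factors out of both sides of the equation. *)
have conj_mu : conj mu = mu.
  by rewrite /mu fmorph_div !rmorphM /= conj_de conj_de' conjK; field; rewrite !(oppr_eq0, de_neq0).
have mu_al : al' * lam ^+ 2 = mu * al.
  by rewrite /mu conj_lam /rho; field; rewrite !(de'_neq0, al_neq0, de_neq0).
have mu_de : de' * (lam * conj lam) = mu * de by rewrite /mu divfK.
exists lam, mu; split=> // x y z; rewrite /affine_eq -[RHS]subr_eq0 -[LHS]subr_eq0.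
have -> : mu * z + al' * ((lam * x) ^+ 2 + (lam * y) ^+ 2)
    = mu * (z + al * (x ^+ 2 + y ^+ 2)).
  transitivity (mu * z + al' * lam ^+ 2 * (x ^+ 2 + y ^+ 2)); first by ring.
  by rewrite mu_al; ring.
have -> : de' * herm (lam * x) (lam * y) = mu * (de * herm x y).
  transitivity (de' * (lam * conj lam) * herm x y); first by rewrite /herm; ring.
  by rewrite mu_de mulrA.
by rewrite rmorphM /= conj_mu -!mulrBr mulf_eq0 (negPf mu0).
Qed.
End Construction.

(** Applying [sig] to the coordinates changes the parameters to [sig al] and [sig de], with the
    invariant of the target; the diagonal scaling of [affine_eq_diag] does the rest, and at infinity
    multiplies [herm] by [lam * conj lam]. *)
Lemma cone_semilinear_exists (sig : {rmorphism F -> F}) al de al' de' :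
  al != 0 -> de != 0 -> conj de = - de -> de' != 0 -> conj de' = - de' ->
  al' * conj al' / de' ^+ 2 = sig (al * conj al / de ^+ 2) ->
  exists2 A : 'M[F]_4, A \in unitmx
    & forall v, cone al de v = cone al' de' (map_mx sig v *m A).
Proof.
move=> al0 de0 cde de'0 cde'; rewrite fmorph_div rmorphM rmorphXn /=.
have -> : sig (conj al) = conj (sig al) by rewrite !conjE rmorphXn.
move=> inv; have al1 : sig al != 0 by rewrite fmorph_eq0.
have de1 : sig de != 0 by rewrite fmorph_eq0.
have cde1 : conj (sig de) = - sig de by rewrite conjE -rmorphXn -conjE cde rmorphN.
have [lam [mu [lam0 mu0 eq_aff]]] := affine_eq_diag al1 de1 cde1 de'0 cde' inv.
pose d := vec4 1 lam lam mu; exists (diag_mx d).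
  rewrite unitmxE det_diag unitfE; apply/prodf_neq0=> i _; rewrite mxE.
  by case: i => -[|[|[|[|//]]]] ? /=; rewrite ?oner_neq0.
move=> v; set w := _ *m _.
have wE (i : 'I_4) : w 0 i = sig (v 0 i) * d 0 i by rewrite /w mul_mx_diag !mxE.
have Jw : cJ w = sig (cJ v) by rewrite /cJ wE mxE inordK //= mulr1.
have Xw : cX w = lam * sig (cX v) by rewrite /cX wE mxE inordK //= mulrC.
have Yw : cY w = lam * sig (cY v) by rewrite /cY wE mxE inordK //= mulrC.
have Zw : cZ w = mu * sig (cZ v) by rewrite /cZ wE mxE inordK //= mulrC.
rewrite /cone Jw Xw Yw Zw fmorph_eq0; case: ifP => _.
  have -> : herm (lam * sig (cX v)) (lam * sig (cY v))
      = (lam * conj lam) * sig (herm (cX v) (cY v)).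
    by rewrite /herm rmorphD !rmorphM /= !conjE !rmorphXn; ring.
  by rewrite !mulf_eq0 !fmorph_eq0 (negPf lam0).
by rewrite (affine_eq_rmorph sig) eq_aff !fmorph_div !mulrA.
Qed.

End Cone.

(** * From sets of projective points to predicates on vectors *)

Section Varieties.
Variables (F : finFieldType) (q : nat) (conj : {rmorphism F -> F}).
Hypotheses (conjE : forall x, conj x = x ^+ q) (q_gt2 : (2 < q)%N).
Implicit Types (a b : F) (v : 'rV[F]_4) (P : {set 'rV[F]_4}).

Lemma mem_point_of v : v \in point_of v.
Proof. by apply/imsetP; exists 1; rewrite ?inE ?scale1r. Qed.

Lemma point_ofZ a v : a != 0 -> point_of (a *: v) = point_of v.
Proof.
move=> a0; apply/setP=> u; apply/imsetP/imsetP=> -[k _ ->].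
  by exists (k * a); rewrite // scalerA.
by exists (k / a); rewrite // scalerA divfK.
Qed.

Lemma eq_point_of v w : point_of v = point_of w -> exists a, v = a *: w.
Proof.
move=> e; have := mem_point_of v; rewrite e => /imsetP[a _ ->].
by exists a.
Qed.

Lemma point_of_PG3 v : (point_of v \in PG3 F) = (v != 0).
Proof.
apply/imsetP/idP=> [[w w0 /esym/eq_point_of[a wE]]|v0]; last by exists v; rewrite ?inE.
by apply: contraTneq w0 => v0; rewrite wE v0 scaler0 inE eqxx.
Qed.

Lemma PG3_point_of P : P \in PG3 F -> exists2 v, v != 0 & P = point_of v.
Proof. by case/imsetP=> v; rewrite inE => v0 ->; exists v. Qed.

(** A point is encoded with all multiples of [v], the zero vector included, whence the requirement
    [B 0] besides homogeneity. *)
Lemma forall_point_of (B : pred 'rV[F]_4) v :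
  B 0 -> (forall a, a != 0 -> B (a *: v) = B v) ->
  [forall u in point_of v, B u] = B v.
Proof.
move=> B0 BZ; apply/forall_inP/idP=> [|Bv _ /imsetP[a _ ->]].
  by apply; apply: mem_point_of.
by have [->|a0] := eqVneq a 0; rewrite ?scale0r // BZ.
Qed.

Lemma point_of_infinity v :
  v != 0 -> (point_of v \in plane_at_infinity F) = (cJ v == 0).
Proof.
move=> v0; rewrite inE point_of_PG3 v0 (forall_point_of (B := fun u => cJ u == 0)) //.
  by rewrite hcoord0.
by move=> a a0; rewrite hcoordZ mulf_eq0 (negPf a0).
Qed.

(** The homogeneous equation is the affine one multiplied by [cJ v ^+ (2 * q)], that is, by
    [conj (cJ v) ^+ 2]. *)
Lemma B_equation_cone a b v : cJ v != 0 ->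
  B_equation q a b v = cone conj a (b ^+ q - b) v.
Proof.
move=> J0; have cJ0 : conj (cJ v) != 0 by rewrite fmorph_eq0.
have expB i : (0 < i <= q)%N -> cJ v ^+ (q - i) = conj (cJ v) / cJ v ^+ i.
  by move=> /andP[_ le_i]; rewrite conjE expfB_cond // (negPf J0).
have expB2 i : (0 < i <= q)%N -> cJ v ^+ (2 * q - i) = conj (cJ v) ^+ 2 / cJ v ^+ i.
  by move=> le_i; rewrite mul2n -addnn -addnBA ?exprD ?expB -?conjE; [ring|lia|lia].
have exp2 x : x ^+ (2 * q) = conj x ^+ 2 by rewrite conjE -exprM mulnC.
rewrite /B_equation /cone (negPf J0) /affine_eq -[LHS]subr_eq0 -[RHS]subr_eq0.
rewrite !expB2 ?expB ?exp2 ?exprD ?expr1; try lia.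
set lhs := (X in X == 0 = _); set rhs := (X in _ = (X == 0)).
have -> : lhs = conj (cJ v) ^+ 2 * rhs.
  rewrite /lhs /rhs /herm !(rmorphD, rmorphM, rmorphXn, fmorph_div) /= -!conjE.
  by field; rewrite J0 cJ0.
by rewrite mulf_eq0 expf_eq0 (negPf cJ0) andbF.
Qed.

Lemma mem_BM_variety a b v : v != 0 ->
  (point_of v \in BM_variety q a b) = cone conj a (b ^+ q - b) v.
Proof.
move=> v0; rewrite 2!inE point_of_infinity // [_ \in F_set _ _]inE point_of_infinity //.
have exp_herm u : cX u ^+ (q + 1) + cY u ^+ (q + 1) = herm conj (cX u) (cY u).
  by rewrite /herm !conjE !exprD !expr1 !(mulrC _ (_ ^+ q)).
have [J0|J0] /= := eqVneq (cJ v) 0.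
  rewrite /cone J0 eqxx (forall_point_of
    (B := fun u => cX u ^+ (q + 1) + cY u ^+ (q + 1) == 0)) ?exp_herm //.
    by rewrite !hcoord0 /herm !mul0r addr0.
  move=> k k0; rewrite !exp_herm /herm !hcoordZ !rmorphM /=.
  have -> : k * cX v * (conj k * conj (cX v)) + k * cY v * (conj k * conj (cY v))
    = k * conj k * (cX v * conj (cX v) + cY v * conj (cY v)) by ring.
  by rewrite !mulf_eq0 fmorph_eq0 (negPf k0).
rewrite orbF inE point_of_PG3 v0 (forall_point_of (B := B_equation q a b)); first exact: B_equation_cone.
  (* Since [0 ^+ 0 = 1], the equation holds at the zero vector thanks to positive exponents. *)
  rewrite /B_equation !hcoord0 !expr0n /=.
  have /negPf-> : q != 0%N by lia.
  have /negPf-> : (2 * q)%N != 0%N by lia.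
  have /negPf-> : (q + 1)%N != 0%N by lia.
  have /negPf-> : (q - 1)%N != 0%N by lia.
  by rewrite !(mulr0, mul0r, addr0, subr0, oppr0).
move=> k k0; rewrite !B_equation_cone ?hcoordZ ?mulf_neq0 // coneZ //.
Qed.

Lemma BM_variety_PG3 a b : BM_variety q a b \subset PG3 F.
Proof.
apply/subsetP=> P; rewrite !inE => /orP[/andP[_ /andP[]]//|/andP[/andP[]//]].
Qed.

Lemma is_field_aut_rmorphism (s : {perm F}) : is_field_aut s ->
  exists sig : {rmorphism F -> F}, sig =1 s.
Proof.
case/and3P=> /eqP s1 /forallP sD /forallP sM.
have sD' x y : s (x + y) = s x + s y by apply/eqP; apply/forallP: y; apply: sD.
have sM' x y : s (x * y) = s x * s y by apply/eqP; apply/forallP: y; apply: sM.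
have sB : zmod_morphism s.
  by move=> x y; apply: (addIr (s y)); rewrite -sD' !subrK.
have sMM : monoid_morphism s by split.
pose h1 := GRing.isZmodMorphism.Build F F s sB.
pose h2 := GRing.isMonoidMorphism.Build F F s sMM.
pose sig : {rmorphism F -> F} := HB.pack (s : F -> F) h1 h2.
by exists sig.
Qed.

Lemma rmorphism_is_field_aut (sig : {rmorphism F -> F}) :
  exists2 s : {perm F}, is_field_aut s & sig =1 s.
Proof.
exists (perm (fmorph_inj sig)); last by move=> x; rewrite permE.
by apply/and3P; split; rewrite ?permE ?rmorph1 //;
   apply/forallP=> x; apply/forallP=> y; rewrite !permE ?rmorphD ?rmorphM.
Qed.

Lemma collineation_point_of A (s : {perm F}) v : is_field_aut s ->
  collineation A s (point_of v) = point_of (Defs.semilinear A s v).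
Proof.
move=> s_aut; have sM a : Defs.semilinear A s (a *: v) = s a *: Defs.semilinear A s v.
  rewrite /Defs.semilinear scalemxAl; congr (_ *m _); apply/matrixP=> i j; rewrite !mxE.
  by case/and3P: s_aut => _ _ /forallP/(_ a)/forallP/(_ (v i j))/eqP.
rewrite /collineation /point_of -imset_comp; apply/setP=> u.
apply/imsetP/imsetP=> -[a _ ->]; first by exists (s a); rewrite //= sM.
by exists (s^-1%g a); rewrite //= sM permKV.
Qed.

Lemma semilinear_inj (A : 'M[F]_4) (s : {perm F}) :
  A \in unitmx -> injective (Defs.semilinear A s).
Proof.
move=> uA v w /(congr1 (mulmx^~ (invmx A))); rewrite /Defs.semilinear !mulmxK //.
by move=> /matrixP e; apply/matrixP=> i j; apply: (@perm_inj _ s); have := e i j; rewrite !mxE.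
Qed.

Lemma PGammaL_equiv_BM a b a' b' :
  reflect (exists (A : 'M[F]_4) (sig : {rmorphism F -> F}), A \in unitmx /\
     forall v, cone conj a (b ^+ q - b) v = cone conj a' (b' ^+ q - b') (map_mx sig v *m A))
    (PGammaL_equiv (BM_variety q a b) (BM_variety q a' b')).
Proof.
apply: (iffP exists_inP) => [[A uA /existsP[s /andP[s_aut /eqP im]]]|[A [sig [uA H]]]].
  have [sig sigE] := is_field_aut_rmorphism s_aut.
  have psiE v : map_mx sig v *m A = Defs.semilinear A s v.
    by congr (_ *m _); apply/matrixP=> i j; rewrite !mxE.
  exists A, sig; split=> // v; rewrite psiE.
  have s0 : Defs.semilinear A s 0 = 0 by rewrite -psiE map_mx0 mul0mx.
  have inj := semilinear_inj (s := s) uA.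
  have [->|v0] := eqVneq v 0; first by rewrite s0 !cone0.
  have pv0 : Defs.semilinear A s v != 0 by rewrite -s0 (inj_eq inj).
  rewrite -!mem_BM_variety // -im -collineation_point_of //.
  apply/idP/imsetP=> [Mv|[P MP e]]; first by exists (point_of v).
  have /PG3_point_of[w w0 wE] := subsetP (BM_variety_PG3 _ _) _ MP.
  move: e MP; rewrite {}wE !collineation_point_of // => /eq_point_of[k e].
  suff -> : point_of v = point_of w by [].
  have k0 : k != 0 by apply: contraNneq pv0 => k0; rewrite e k0 scale0r.
  (* A factor [k] between the images is a factor [s^-1 k] between the vectors. *)
  rewrite -[RHS](point_ofZ _ (a := s^-1%g k)); last first.
    have [sig' E] := is_field_aut_rmorphism (is_field_autV s_aut).
    by rewrite -E fmorph_eq0.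
  congr point_of; apply: inj; rewrite e -!psiE map_mxZ -scalemxAl sigE permKV //.
have [s s_aut sigE] := rmorphism_is_field_aut sig.
exists A => //; apply/existsP; exists s; rewrite s_aut /=.
have psiE v : map_mx sig v *m A = Defs.semilinear A s v.
  by congr (_ *m _); apply/matrixP=> i j; rewrite !mxE.
have s0 : Defs.semilinear A s 0 = 0 by rewrite -psiE map_mx0 mul0mx.
have inj := semilinear_inj (s := s) uA.
apply/eqP/setP=> P; apply/imsetP/idP=> [[Q MQ ->]|MP].
  have /PG3_point_of[w w0 wE] := subsetP (BM_variety_PG3 _ _) _ MQ.
  move: MQ; rewrite wE collineation_point_of // !mem_BM_variety // -?psiE ?H //.
  by rewrite psiE -s0 (inj_eq inj).
have /PG3_point_of[w w0 wE] := subsetP (BM_variety_PG3 _ _) _ MP.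
have [g _ gK] := injF_bij inj.
exists (point_of (g w)); last by rewrite collineation_point_of // gK.
have gw0 : g w != 0 by apply: contra_neq w0 => g0; rewrite -(gK w) g0.
by rewrite mem_BM_variety // H psiE gK -mem_BM_variety // -wE.
Qed.

End Varieties.

(** * Two counting lemmas: images with the same fibres, and sums over gcds *)

Lemma card_imset_eq (T U V : finType) (f : T -> U) (g : T -> V) (P : {set T}) :
  {in P &, forall x y, (f x == f y) = (g x == g y)} -> #|f @: P| = #|g @: P|.
Proof.
(* [h] maps [f x] to the singleton of [g x], which avoids choosing preimages. *)
move=> fg; pose h y := [set g x | x in P & f x == y].
have hf x : x \in P -> h (f x) = [set g x].
  move=> Px; apply/setP=> z; rewrite inE.
  apply/imsetP/eqP=> [[y /[!inE]/andP[Py] fxy ->]|->]; last by exists x; rewrite // !inE Px eqxx.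
  by apply/eqP; rewrite -fg.
have <- : #|h @: (f @: P)| = #|f @: P|.
  apply: card_in_imset => _ _ /imsetP[x Px ->] /imsetP[y Py ->].
  by rewrite !hf // => /set1_inj /eqP; rewrite -fg // => /eqP.
have <- : #|set1 @: (g @: P)| = #|g @: P| by apply: card_imset => x y /set1_inj.
congr #|pred_of_set _|; rewrite -!imset_comp.
by apply: eq_in_imset => x Px; rewrite /= hf.
Qed.

(** Grouping by [d = gcdn i n], the indices with this gcd are the [j * d] with [j < n %/ d] coprime
    to [n %/ d]. *)
Lemma sum_gcdn_totient (f : nat -> nat) n : (0 < n)%N ->
  (\sum_(i < n) f (gcdn i n) = \sum_(d <- divisors n) totient (n %/ d) * f d)%N.
Proof.
move=> n_gt0; transitivity
    (\sum_(i < n) \sum_(d <- divisors n) (gcdn i n == d) * f d)%N.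
  apply: eq_bigr => i _; rewrite (bigD1_seq (gcdn i n)) ?divisors_uniq //=; last first.
    by rewrite -dvdn_divisors // dvdn_gcdr.
  rewrite eqxx mul1n big1 ?addn0 // => d /negPf; rewrite eq_sym => -> //.
rewrite exchange_big; apply: eq_big_seq => d /=; rewrite -dvdn_divisors // => d_dv.
rewrite -big_distrl; congr (_ * _)%N.
have d_gt0 := dvdn_gt0 n_gt0 d_dv; set m := (n %/ d)%N; have nE : n = (m * d)%N by rewrite divnK.
rewrite totient_count_coprime -(big_mkord xpredT (fun i => nat_of_bool (gcdn i n == d))).
(* The range is cut into [m] blocks of length [d], in which only the first index is a multiple of
   [d]. *)
rewrite {1}nE big_nat_mul; apply: eq_big_nat => j _.
rewrite -{1}[(j * d)%N]add0n big_addn mulSn addnK; case: d d_gt0 {d_dv} @m nE => // d _ m nE.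
rewrite big_nat_recl // big1_seq => [|i /andP[_]]; last first.
  rewrite mem_index_iota => /andP[_ lt_id]; apply/eqP; rewrite eqb0; apply/negP=> /eqP gd.
  have := dvdn_gcdl (i.+1 + j * d.+1) n; rewrite gd.
  by rewrite dvdn_addl ?dvdn_mull // => /dvdn_leq; lia.
by rewrite /= addn0 add0n nE -muln_gcdl coprime_sym /coprime -[X in _ == X]mul1n eqn_pmul2r.
Qed.

(** * Frobenius orbits on the values of the invariant, and Burnside's lemma *)

Section FrobeniusOrbits.
Variables (p n : nat) (F : finFieldType).
Hypotheses (p_prime : prime p) (p_odd : odd p) (n_gt0 : (0 < n)%N).
Hypothesis cardF : #|F| = ((p ^ n) ^ 2)%N.
Let q := (p ^ n)%N.
Let m := (2 * n).-1.

Let mE : m.+1 = (2 * n)%N. Proof. by rewrite /m prednK //; lia. Qed.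

Lemma card_field_2n : #|F| = (p ^ (2 * n))%N.
Proof. by rewrite cardF -expnM mulnC. Qed.

Lemma finField_frobenius_rmorphism k :
  exists phi : {rmorphism F -> F}, forall x, phi x = x ^+ (p ^ k).
Proof.
have pF := card_finPcharP card_field_2n p_prime.
elim: k => [|k [phi phiE]]; first by exists idfun.
exists (pFrobenius_aut pF \o phi) => x /=.
by rewrite phiE pFrobenius_autE -exprM -expnSr.
Qed.

Lemma odd_prime_power_gt2 : (2 < q)%N.
Proof.
have p_gt2 : (2 < p)%N by have := prime_gt1 p_prime; case: p p_odd => [|[|[]]].
by apply: leq_trans p_gt2 _; rewrite /q -{1}(expn1 p) leq_exp2l ?prime_gt1.
Qed.

Lemma odd_prime_power_odd : odd q. Proof. by rewrite /q oddX p_odd orbT. Qed.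

Lemma odd_char_two_neq0 : 2%:R != 0 :> F.
Proof.
have pF := card_finPcharP card_field_2n p_prime.
rewrite -(dvdn_pcharf pF) dvdn_prime2 //; by apply: contraTneq p_odd => ->.
Qed.

(* Frobenius generates a group of order 2n, acting on F through 'I_m.+1 with
   [m.+1 = 2n]. *)
Definition frob_act (x : F) (i : 'I_m.+1) : F := x ^+ (p ^ i).

Lemma frob_act1 : frob_act^~ 1%g =1 id.
Proof. by move=> x; rewrite /frob_act expn0 expr1. Qed.

Lemma frob_actM x : act_morph frob_act x.
Proof.
(* Indices add modulo 2n, and a full turn is the identity because [x ^+ #|F| = x]. *)
move=> i j; rewrite /frob_act -exprM -expnD /= [in RHS](divn_eq (i + j) m.+1).
rewrite expnD exprM; congr (_ ^+ _).
apply/esym/(@expf_frobenius_fixed_dvd _ _ m.+1); first exact: dvdn_mull.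
by rewrite mE -card_field_2n expf_card.
Qed.

Definition frob_action : {action 'I_m.+1 &-> F} := TotalAction frob_act1 frob_actM.

(** The values of the invariant: it lies in GF(q), [alpha != 0] excludes 0, and the nondegeneracy
    condition excludes -1. *)
Definition admissible : {set F} := [set t | [&& t ^+ q == t, t != 0 & t != -1]].

Lemma frob_orbitP (x y : F) :
  reflect (exists sig : {rmorphism F -> F}, y = sig x)
    (y \in orbit frob_action [set: 'I_m.+1] x).
Proof.
apply: (iffP orbitP) => [[i _ <-]|[sig ->]].
  have [phi phiE] := finField_frobenius_rmorphism i.
  by exists phi; rewrite phiE.
have [j lt_j ->] := finField_rmorph_frobenius p_prime card_field_2n sig.
rewrite -mE in lt_j; by exists (Ordinal lt_j).
Qed.

Lemma acts_frob_admissible :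
  [acts [set: 'I_m.+1], on admissible | frob_action].
Proof.
apply/actsP=> i _ x /=; rewrite !inE /= /frob_act.
have [phi phiE] := finField_frobenius_rmorphism i.
rewrite -phiE -rmorphXn (inj_eq (fmorph_inj phi)) fmorph_eq0.
by rewrite -(inj_eq (fmorph_inj phi) x (-1)) rmorphN1.
Qed.

(** Being fixed by the powers [i] and [n] of Frobenius means lying in the subfield of order
    [p ^ gcdn i n]. The excluded 0 and -1 always lie there, which is the source of the final
    subtraction of 2. *)
Lemma card_frob_fixed (i : 'I_m.+1) :
  (#|'Fix_(admissible | frob_action)[i]%g| + 2 = p ^ gcdn i n)%N.
Proof.
set Fx := 'Fix_(_ | _)[_]%g.
have N1X k : odd k -> (-1) ^+ k = -1 :> F by rewrite -signr_odd => ->.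
have gd : (gcdn i n %| 2 * n)%N by rewrite dvdn_mull // dvdn_gcdr.
rewrite -(card_frobenius_fixed p_prime card_field_2n gd).
have pg0 k : (p ^ k == 0)%N = false by rewrite expn_eq0 -leqn0 leqNgt prime_gt0.
suff -> : [set x : F | x ^+ (p ^ gcdn i n) == x] = Fx :|: [set 0; -1].
  rewrite cardsU cards2 eq_sym oppr_eq0 oner_eq0 /= disjoint_setI0 ?cards0 ?subn0 //.
  rewrite disjoint_sym disjoints_subset; apply/subsetP=> x; rewrite !inE.
  by case/orP=> /eqP->; rewrite ?eqxx ?andbF.
apply/setP=> x; rewrite inE in_setU in_setI in_set2 [x \in admissible]inE.
have [->|x0] /= := eqVneq x 0; first by rewrite expr0n pg0 eqxx orbT.
have [->|x1] /= := eqVneq x (-1).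
  by rewrite N1X ?eqxx ?orbT // oddX p_odd orbT.
rewrite orbF andbT; apply/eqP/andP=> [xg|[/eqP xq /afix1P xi]].
  split; first by rewrite (expf_frobenius_fixed_dvd (dvdn_gcdr i n) xg).
  by apply/afix1P; apply: (expf_frobenius_fixed_dvd (dvdn_gcdl i n) xg).
by rewrite gcdnC; apply: expf_frobenius_fixed_gcd.
Qed.

(** Burnside for a group of order 2n. As [gcdn i n] has period [n] in [i], the sum over 2n indices
    is twice the sum over [n], and the factor 2 cancels. *)
Lemma card_frob_orbits :
  ((#|[set orbit frob_action [set: 'I_m.+1] x | x in admissible]| + 2) * n
    = \sum_(k <- divisors n) totient (n %/ k) * p ^ k)%N.
Proof.
have := Frobenius_Cauchy acts_frob_admissible.
rewrite cardsT card_ord; set N := #|_| => burnside.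
apply/eqP; rewrite -(eqn_pmul2l (isT : 0 < 2)%N); apply/eqP.
have -> : (2 * ((N + 2) * n) = N * m.+1 + 2 * m.+1)%N by rewrite mE; lia.
rewrite -burnside.
have -> : (2 * m.+1 = \sum_(i in [set: 'I_m.+1]) 2)%N.
  by rewrite sum_nat_const cardsT card_ord mulnC.
rewrite -big_split /= (eq_bigr (fun i : 'I_m.+1 => p ^ gcdn i n)%N); last first.
  by move=> i _; exact: card_frob_fixed.
rewrite (eq_bigl xpredT) => [|i]; last by rewrite inE.
rewrite -(big_mkord xpredT (fun i => p ^ gcdn i n)%N) mE mul2n -addnn.
rewrite (@big_cat_nat _ _ _ n) ?leq_addr //= -[X in index_iota X (n + n)]add0n big_addn addnK.
under [X in (_ + X)%N]eq_bigr => i _ do rewrite gcdnC gcdnDr gcdnC.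
by rewrite addnn -mul2n big_mkord (sum_gcdn_totient (fun g => p ^ g)%N n_gt0).
Qed.

(** The factor 4 normalises the degenerate value to -1. *)
Definition BM_invariant (ab : F * F) : F :=
  4%:R * ab.1 ^+ (q + 1) / (ab.2 ^+ q - ab.2) ^+ 2.

Let four_neq0 : 4%:R != 0 :> F.
Proof. by rewrite (natrM _ 2 2) mulf_neq0 ?odd_char_two_neq0. Qed.

Section Conj.
Variable conj : {rmorphism F -> F}.
Hypothesis conjE : forall x, conj x = x ^+ q.

Let conj_conj x : conj (conj x) = x.
Proof. exact: (conjK conjE cardF). Qed.

Lemma BM_paramsP (ab : F * F) : ab \in BM_params F q ->
  [/\ ab.1 != 0, ab.2 ^+ q - ab.2 != 0
    & conj (ab.2 ^+ q - ab.2) = - (ab.2 ^+ q - ab.2)].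
Proof.
rewrite inE => /and3P[a0 b_notin _]; split=> //.
  by move: b_notin; rewrite inE subr_eq0.
by rewrite -conjE rmorphB /= conj_conj opprB.
Qed.

Lemma BM_invariantE ab :
  BM_invariant ab = 4%:R * (ab.1 * conj ab.1 / (ab.2 ^+ q - ab.2) ^+ 2).
Proof. by rewrite /BM_invariant exprD expr1 -conjE [_ * ab.1]mulrC !mulrA. Qed.

Lemma PGammaL_equiv_BM_invariant (ab ab' : F * F) :
  ab \in BM_params F q -> ab' \in BM_params F q ->
  PGammaL_equiv (BM_variety q ab.1 ab.2) (BM_variety q ab'.1 ab'.2)
    = (BM_invariant ab' \in orbit frob_action [set: 'I_m.+1] (BM_invariant ab)).
Proof.
case: ab ab' => a b [a' b'] /BM_paramsP[/= a0 d0 cd] /BM_paramsP[/= a'0 d'0 cd'].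
apply/(PGammaL_equiv_BM conjE odd_prime_power_gt2)/frob_orbitP.
  case=> A [sig [uA H]]; exists sig.
  have inv := cone_semilinear_invariant conjE odd_prime_power_odd
    odd_prime_power_gt2 cardF odd_char_two_neq0
    (psi := fun v => map_mx sig v *m A) (sig := sig).
  rewrite !BM_invariantE rmorphM rmorph_nat /=; congr (_ * _).
  apply: inv H => //.
  - by move=> v w; rewrite map_mxD mulmxDl.
  - by move=> k v; rewrite map_mxZ -scalemxAl.
  move=> v w /(congr1 (mulmx^~ (invmx A))); rewrite !mulmxK //.
  exact: map_mx_inj.
case=> sig; rewrite !BM_invariantE rmorphM rmorph_nat /= => /(mulfI four_neq0) inv.
have [A uA H] := cone_semilinear_exists conjE odd_prime_power_odd
  odd_prime_power_gt2 cardF odd_char_two_neq0 a0 d0 cd d'0 cd' inv.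
by exists A, sig.
Qed.

Lemma BM_invariant_image : BM_invariant @: BM_params F q = admissible.
Proof.
apply/setP=> t; apply/imsetP/idP=> [[ab abP ->]|].
  have [a0 d0 cd] := BM_paramsP abP; move: abP; rewrite inE => /and3P[_ _ cond].
  rewrite inE -conjE; apply/and3P; split.
  - rewrite BM_invariantE; set d := _ - _ in cd *.
    by rewrite rmorphM rmorph_nat fmorph_div rmorphM rmorphXn /= cd conj_conj sqrrN (mulrC (conj _)).
  - by rewrite !mulf_neq0 ?invr_neq0 ?expf_neq0.
  apply: contraNneq cond => eN1; set d := _ - _ in d0 cd eN1 *.
  have -> : 4%:R * ab.1 ^+ (q + 1) = BM_invariant ab * d ^+ 2.
    by rewrite /BM_invariant -/d divfK ?expf_neq0.
  by rewrite eN1 mulN1r addNr.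
rewrite inE => /and3P[/eqP tq t0 t1].
(* Any [b] outside GF(q) will do; one exists since GF(q) has only q < q^2 elements. *)
have [b b_notin] : exists b : F, b \notin GFq F q.
  apply/existsP; rewrite -negb_forall; apply/negP=> /forallP all_q.
  have card_q : #|[set x : F | x ^+ (p ^ n) == x]| = (p ^ n)%N.
    by apply: (card_frobenius_fixed p_prime card_field_2n); apply: dvdn_mull.
  have : #|[set: F]| = q.
    by rewrite /q -card_q; apply: eq_card => x; have := all_q x; rewrite !inE => ->.
  rewrite cardsT cardF -/q => /eqP; rewrite -[X in _ == X]expn1 eqn_exp2l //.
  exact: leq_trans odd_prime_power_gt2.
have d0 : b ^+ q - b != 0 by move: b_notin; rewrite inE subr_eq0.
set d := b ^+ q - b in d0.
have cd : conj d = - d by rewrite /d -conjE rmorphB /= conj_conj opprB.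
(* The required norm of [a]: [d ^+ 2] is fixed by [conj] because [d] is antifixed, so [y] lies in
   GF(q) and is a norm. *)
pose y := t * d ^+ 2 / 4%:R.
have y0 : y != 0 by rewrite !mulf_neq0 ?invr_neq0 ?expf_neq0.
have yq : y ^+ q.-1 = 1.
  apply: (mulfI y0); rewrite mulr1 -exprS prednK; last by have := odd_prime_power_gt2; lia.
  by rewrite -conjE /y fmorph_div rmorphM rmorphXn rmorph_nat /= cd sqrrN conjE tq.
have qq : (#|F|.-1 = q.+1 * q.-1)%N by rewrite cardF -/q; have := odd_prime_power_gt2; nia.
have [|a a0 ya] := finField_root_of_unity _ yq; first by rewrite qq dvdn_mull.
rewrite qq mulnK in ya; last by have := odd_prime_power_gt2; lia.
have ya' : 4%:R * a ^+ (q + 1) = t * d ^+ 2 by rewrite addn1 -ya /y mulrC divfK.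
exists (a, b); last by rewrite /BM_invariant /= ya' mulfK ?expf_neq0.
rewrite inE /= a0 b_notin ya' -/d -[X in _ + X]mul1r -mulrDl.
by rewrite mulf_neq0 ?expf_neq0 // addr_eq0.
Qed.

Lemma card_BM_classes : #|BM_classes F q|
  = #|[set orbit frob_action [set: 'I_m.+1] x | x in admissible]|.
Proof.
rewrite -BM_invariant_image -imset_comp /BM_classes /equivalence_partition.
rewrite /BM_varieties -imset_comp; apply: card_imset_eq => ab ab' abP ab'P /=.
have equiv := PGammaL_equiv_equivalence (F := F).
rewrite -/(BM_varieties F q); set D := BM_varieties F q.
(* Equality of classes and equality of orbits are both compared with equivalence of the two
   varieties. *)
transitivity (PGammaL_equiv (BM_variety q ab'.1 ab'.2) (BM_variety q ab.1 ab.2)).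
  apply/eqP/idP=> [/setP/(_ (BM_variety q ab.1 ab.2))|e].
    have MD : BM_variety q ab.1 ab.2 \in D by apply/imsetP; exists ab.
    have [R_refl _] := equiv set0 set0 (BM_variety q ab.1 ab.2).
    by rewrite [LHS]inE [RHS]inE MD R_refl => /esym.
  apply/setP=> S; rewrite [LHS]inE [RHS]inE; congr (_ && _).
  by have [_ ->] := equiv (BM_variety q ab'.1 ab'.2) (BM_variety q ab.1 ab.2) S.
by rewrite PGammaL_equiv_BM_invariant //; apply/orbit_eqP/eqP.
Qed.

End Conj.
End FrobeniusOrbits.

Theorem theorem1p1 (p n : nat) (F : finFieldType)
    (p_prime : prime p) (p_odd : odd p) (n_ge1 : (1 <= n)%N)
    (card_F : #|F| = ((p ^ n) ^ 2)%N) :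
  #|BM_classes F (p ^ n)|%:R =
    n%:R^-1 * (\sum_(k <- divisors n) (totient (n %/ k) * p ^ k)%N%:R) - 2%:R
    :> rat.
Proof.
have [conj conjE] := finField_frobenius_rmorphism p_prime card_F n.
rewrite (card_BM_classes p_prime p_odd n_ge1 card_F conjE).
rewrite -natr_sum -(card_frob_orbits p_prime p_odd n_ge1 card_F) natrM natrD mulrC mulfK ?addrK //.
by rewrite Num.Theory.pnatr_eq0 -lt0n.
Qed.
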